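(* Let $t\ge2$, $\ell\ge1$, and let $\mathbf{T}$ be a $t$-uniform relational structure that is lax and $\ell$-null-constraining and such that $\mathrm{CSP}(\mathbf{T})$ is not trivially satisfiable. Then there exist $\Delta>0$ depending only on $\mathbf{T}$ and $\zeta=\zeta(t,\ell,\Delta)>0$, $\delta=\delta(t,\ell,\Delta)>0$ such that, for $\mathbf{A}\sim\mathrm{CSP}_{n,\Delta n}(\mathbf{T})$: with probability $1-o(1)$ as $n\to\infty$ there is no homomorphism $\mathbf{A}\to\mathbf{T}$, and with probability at least $\delta-o(1)$ the cohomological $k$-consistency algorithm for $\mathrm{CSP}(\mathbf{T})$ accepts $\mathbf{A}$ for all $k\le\zeta n$. Consequently, the cohomological $k$-consistency algorithm does not solve $\mathrm{CSP}(\mathbf{T})$ for any $k\le\zeta n$.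
   Context: Relational structures and CSPs: a signature $\sigma$ is a finite set of relation symbols with arities; a $\sigma$-structure $\mathbf{A}$ has a finite domain $A$ and relations $\Gamma^{\mathbf{A}}\subseteq A^{\mathrm{ar}(\Gamma)}$. A homomorphism $\mathbf{A}\to\mathbf{T}$ is a map $A\to T$ sending every tuple of $\Gamma^{\mathbf{A}}$ into $\Gamma^{\mathbf{T}}$ for every $\Gamma\in\sigma$. An instance of $\mathrm{CSP}(\mathbf{T})$ is a $\sigma$-structure $\mathbf{A}$ no tuple of whose relations has repeated entries. For $X\subseteq A$, $\mathbf{A}[X]$ is the substructure with domain $X$ whose relations consist of the tuples of $\mathbf{A}$ with all entries in $X$, and $\mathrm{Hom}(\mathbf{A}[X],\mathbf{T})$ is the set of homomorphisms $\mathbf{A}[X]\to\mathbf{T}$. A structure is $t$-uniform if all its relations have arity $t$. The hypergraph of an instance $\mathbf{A}$ (of a $t$-uniform template) is $(A,\mathcal{E})$ with $\mathcal{E}=\{\{a_1,\dots,a_t\}:(a_1,\dots,a_t)\in\Gamma^{\mathbf{A}}\text{ for some }\Gamma\in\sigma\}$. Hypergraph paths: a (Berge) path of length $p$ in a hyperedge set is a sequence of distinct vertices $v_0,\dots,v_p$ and distinct hyperedges $e_0,\dots,e_{p-1}$ with $\{v_i,v_{i+1}\}\subseteq e_i$; it is simple if each vertex of $e_i\setminus\{v_i,v_{i+1}\}$ lies in only one of the $e_j$, and each $v_i$ with $0<i<p$ lies in exactly two of the $e_j$. A simple path instance of $\mathrm{CSP}(\mathbf{T})$ of length $p$ is an instance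 whose hypergraph is (the edge set of) a simple path of length $p$, with endpoints $v_0,v_p$; it permits $(i_1,i_2)\in T^2$ if some homomorphism to $\mathbf{T}$ maps $v_0\mapsto i_1$, $v_p\mapsto i_2$. $\mathbf{T}$ is lax if for every $\Gamma\in\sigma$ and $j\in[t]$ there are $b_1,\dots,b_{j-1},b_{j+1},\dots,b_t\in T$ with $(b_1,\dots,b_{j-1},a,b_{j+1},\dots,b_t)\in\Gamma^{\mathbf{T}}$ for all $a\in T$. $\mathbf{T}$ is $\ell$-null-constraining if every simple path instance of length at least $\ell$ permits every pair in $T^2$. $\mathrm{CSP}(\mathbf{T})$ is trivially satisfiable if for some $i\in T$ the constant map to $i$ is a homomorphism from every instance. $\mathrm{CSP}_{n,m}(\mathbf{T})$: choose a $t$-uniform hypergraph on vertex set $A$ of size $n$ with $m$ hyperedges uniformly at random; for each hyperedge $e$ choose independently and uniformly a ordering $\pi_e$ of its vertices (a $t$-tuple) and a symbol $\Gamma_e\in\sigma$; set $\Gamma^{\mathbf{A}}=\{\pi_e:\Gamma_e=\Gamma\}$. (Non-integer $\Delta n$ is rounded down.) Cohomological $k$-consistency: fix $\mathbf{T}$, an instance $\mathbf{A}$, and $k\ge1$. A collection $\kappa=\{\kappa(X): X\subseteq A,|X|\le k\}$ with $\kappa(X)\subseteq\mathrm{Hom}(\mathbf{A}[X],\mathbf{T})$ is $k$-consistent if for all $Y\subseteq X\subseteq A$ with $|X|\le k$: (extendability) every $\varphi\in\kappa(Y)$ is the restriction to $Y$ of some $\psi\in\kappa(X)$; (down-closure)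 for every $\psi\in\kappa(X)$, its restriction $\psi|_Y$ lies in $\kappa(Y)$. Every such collection contains a unique maximal $k$-consistent subcollection. For such $\kappa$, $L_k(\mathbf{A},\mathbf{T},\kappa)$ is the system of linear equations in variables $x_{X,\varphi}$ ($|X|\le k$, $\varphi\in\mathrm{Hom}(\mathbf{A}[X],\mathbf{T})$): $\sum_{\varphi\in\kappa(X)}x_{X,\varphi}=1$ for every $X$ with $|X|\le k$, and $\sum_{\varphi\in\kappa(X),\,\varphi|_Y=\psi}x_{X,\varphi}=x_{Y,\psi}$ for all $Y\subseteq X$, $|X|\le k$, $\psi\in\kappa(Y)$. The cohomological $k$-consistency algorithm for $\mathrm{CSP}(\mathbf{T})$ on input $\mathbf{A}$: initialize $\mathcal{H}(X)=\mathrm{Hom}(\mathbf{A}[X],\mathbf{T})$ for all $|X|\le k$; repeat until $\mathcal{H}$ no longer changes: (a) replace $\mathcal{H}$ by its maximal $k$-consistent subcollection; (b) for each $X$ with $|X|\le k$ and each $\varphi\in\mathcal{H}(X)$, if $L_k(\mathbf{A},\mathbf{T},\mathcal{H})$ has no solution over $\mathbb{Z}$ with $x_{X,\varphi}=1$ and $x_{X,\psi}=0$ for all $\psi\in\mathcal{H}(X)\setminus\{\varphi\}$, then remove $\varphi$ from $\mathcal{H}(X)$ for the next iteration. Finally, reject if $\mathcal{H}(X)=\emptyset$ for some $X$, and accept otherwise. *)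

(* Defs.v *)
From Stdlib Require Import Reals ClassicalEpsilon.
From mathcomp Require Import all_boot all_order all_algebra.

Set Implicit Arguments.
Unset Strict Implicit.
Unset Printing Implicit Defensive.

Definition pdec (P : Prop) : bool :=
  if excluded_middle_informative P then true else false.

Section Structures.
Variables (t s : nat).
(* A t-uniform structure over the signature 'I_s (s relation symbols, all of
   arity t) with domain D is a family  'I_s -> {set t.-tuple D}. *)

Definition is_hom (A B : finType) (RA : 'I_s -> {set t.-tuple A})
  (RB : 'I_s -> {set t.-tuple B}) (h : A -> B) : Prop :=
  forall (G : 'I_s) (tu : t.-tuple A), tu \in RA G -> map_tuple h tu \in RB G.

Definition is_instance (A : finType) (RA : 'I_s -> {set t.-tuple A}) : Prop :=
  forall (G : 'I_s) (tu : t.-tuple A), tu \in RA G -> uniq tu.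

Definition hedges (A : finType) (RA : 'I_s -> {set t.-tuple A}) : {set {set A}} :=
  \bigcup_(G : 'I_s) [set [set x | x \in (tu : seq A)] | tu : t.-tuple A in RA G].

Definition lax (D : finType) (RT : 'I_s -> {set t.-tuple D}) : Prop :=
  forall (G : 'I_s) (j : 'I_t), exists b : t.-tuple D,
    forall a : D, [tuple (if i == j then a else tnth b i) | i < t] \in RT G.

(* Berge path of length p: vertices v 0..v p, hyperedges e 0..e (p-1). *)
Definition simple_path (A : finType) (E : {set {set A}}) (p : nat)
  (v : nat -> A) (e : nat -> {set A}) : Prop :=
  (forall i j, (i <= p)%N -> (j <= p)%N -> v i = v j -> i = j) /\
  (forall i j, (i < p)%N -> (j < p)%N -> e i = e j -> i = j) /\
  (forall i, (i < p)%N -> e i \in E) /\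
  (forall i, (i < p)%N -> v i \in e i /\ v i.+1 \in e i) /\
  (forall i x, (i < p)%N -> x \in e i -> x != v i -> x != v i.+1 ->
     #|[set j : 'I_p | x \in e j]| = 1%N) /\
  (forall i, (0 < i)%N -> (i < p)%N -> #|[set j : 'I_p | v i \in e j]| = 2%N).

Definition simple_path_instance (A : finType) (RA : 'I_s -> {set t.-tuple A})
  (p : nat) (v : nat -> A) (e : nat -> {set A}) : Prop :=
  is_instance RA /\ simple_path (hedges RA) p v e /\
  hedges RA = [set e (nat_of_ord j) | j : 'I_p].

Definition null_constraining (l : nat) (D : finType)
  (RT : 'I_s -> {set t.-tuple D}) : Prop :=
  forall (n p : nat) (RA : 'I_s -> {set t.-tuple 'I_n})
    (v : nat -> 'I_n) (e : nat -> {set 'I_n}),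
    (l <= p)%N -> simple_path_instance RA p v e ->
    forall i1 i2 : D, exists h : 'I_n -> D,
      is_hom RA RT h /\ h (v 0%N) = i1 /\ h (v p) = i2.

Definition trivially_satisfiable (D : finType) (RT : 'I_s -> {set t.-tuple D})
  : Prop :=
  exists i : D, forall (n : nat) (RA : 'I_s -> {set t.-tuple 'I_n}),
    is_instance RA -> is_hom RA RT (fun _ => i).

Section Cohom.
Variables (n : nat) (D : finType) (RA : 'I_s -> {set t.-tuple 'I_n})
  (RT : 'I_s -> {set t.-tuple D}).

Definition pmap := {ffun 'I_n -> option D}.
Definition pdom (phi : pmap) : {set 'I_n} := [set x | phi x != None].
Definition restr (Y : {set 'I_n}) (phi : pmap) : pmap :=
  [ffun x => if x \in Y then phi x else None].

Definition homX (X : {set 'I_n}) : {set pmap} :=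
  [set phi : pmap | (pdom phi == X) &&
    [forall G : 'I_s, forall tu in RA G,
      all (fun x => x \in X) tu ==>
      [exists u in RT G, [seq Some y | y <- (u : seq D)] ==
                         [seq phi x | x <- (tu : seq 'I_n)]]]].

Definition coll := {ffun {set 'I_n} -> {set pmap}}.

Definition consistent (k : nat) (kap : coll) : bool :=
  [forall X : {set 'I_n}, forall Y : {set 'I_n},
    ((#|X| <= k) && (Y \subset X)) ==>
    ([forall phi in kap Y, [exists psi in kap X, restr Y psi == phi]] &&
     [forall psi in kap X, restr Y psi \in kap Y])].

Definition subcoll (k : nat) (kap H : coll) : bool :=
  [forall X : {set 'I_n}, (#|X| <= k) ==> (kap X \subset H X)].

Definition maxcons (k : nat) (H : coll) : coll :=
  [ffun X : {set 'I_n} => if (#|X| <= k)%N then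
     \bigcup_(kap : coll | subcoll k kap H && consistent k kap) kap X
   else set0].

Definition Lk_solvable (k : nat) (kap : coll) (X : {set 'I_n}) (phi : pmap)
  : Prop :=
  exists z : {set 'I_n} -> pmap -> int,
    (forall X' : {set 'I_n}, (#|X'| <= k)%N ->
        (\sum_(psi in kap X') z X' psi = 1)%R) /\
    (forall (X' Y : {set 'I_n}), (#|X'| <= k)%N -> Y \subset X' ->
       forall psi, psi \in kap Y ->
         (\sum_(phi' in kap X' | restr Y phi' == psi) z X' phi')%R = z Y psi) /\
    z X phi = 1%R /\
    (forall psi, psi \in kap X -> psi != phi -> z X psi = 0%R).

Definition cstep (k : nat) (H : coll) : coll :=
  let H' := maxcons k H in
  [ffun X : {set 'I_n} => [set phi in H' X | pdec (Lk_solvable k H' X phi)]].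

Definition cinit (k : nat) : coll :=
  [ffun X : {set 'I_n} => if (#|X| <= k)%N then homX X else set0].

Definition cohom_accepts (k : nat) : Prop :=
  exists i : nat,
    iter i.+1 (cstep k) (cinit k) = iter i (cstep k) (cinit k) /\
    forall X : {set 'I_n}, (#|X| <= k)%N -> iter i (cstep k) (cinit k) X != set0.

End Cohom.

(* An outcome assigns to each subset e of 'I_n either None (e is not a
   hyperedge) or Some (pi_e, Gamma_e).  Valid outcomes: exactly m hyperedges,
   each pi_e an ordering of e (hence |e| = t).  The distribution of CSP_{n,m}
   is uniform on valid outcomes. *)
Definition outcome (n : nat) :=
  {ffun {set 'I_n} -> option (t.-tuple 'I_n * 'I_s)}.

Definition valid_outcome (n m : nat) (g : outcome n) : bool :=
  (#|[set e | g e != None]| == m) &&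
  [forall e, match g e with
             | None => true
             | Some (tu, _) => uniq tu && ([set x | x \in (tu : seq 'I_n)] == e)
             end].

Definition inst_of (n : nat) (g : outcome n) : 'I_s -> {set t.-tuple 'I_n} :=
  fun G => [set tu : t.-tuple 'I_n | [exists e, g e == Some (tu, G)]].

Definition prob (n m : nat) (E : ('I_s -> {set t.-tuple 'I_n}) -> Prop) : R :=
  Rdiv (INR #|[set g : outcome n | valid_outcome m g && pdec (E (inst_of g))]|)
       (INR #|[set g : outcome n | valid_outcome m g]|).

End Structures.

Definition floorR (x : R) : nat := Z.to_nat (Int_part x).
Arguments prob {t s} n m E.

(* Main.v *)
Require Import Defs.
From Stdlib Require Import Reals ClassicalEpsilon.
From Stdlib Require Lra.
From mathcomp Require Import all_boot all_order all_algebra.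
From mathcomp Require Import Rstruct.
From mathcomp Require Import ring lra zify.

Set Implicit Arguments.
Unset Strict Implicit.
Unset Printing Implicit Defensive.

Import Order.TTheory GRing.Theory Num.Theory.

(** Call a vertex set [Z] closed if every small set [F] of hyperedges not inside
    [Z] covers at least [(t - 1 - 1/q) |F|] vertices outside [Z].  Closed sets are
    stable under intersection, and in a sparse hypergraph every small set lies in
    a small closed set, hence has a closure.  If there are also no short cycles,
    then for closed [Z] inside a small closed [X] one assignment of [X \ Z]
    extends all homomorphisms on [Z] at once: remove pendant edges, where laxness
    gives values that do not depend on the attaching vertex, and paths of [l]
    edges, where null-constraining gives values for any two ends.  Counting
    degrees shows that otherwise too few vertices would be covered.

    Let [kappa X] consist of the restrictions to [X] of the homomorphisms on the
    closure of [X].  As the extensions are uniform, a compatible family of integer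
    combinations of homomorphisms on the proper closed subsets of [X] lifts to
    [X], by corrections made in order of size.  Hence each single homomorphism is
    part of an integral solution, and [kappa] survives every step of the algorithm.

    In the binomial model sparsity fails with small probability by a first moment
    bound, and short cycles are absent with probability bounded below, since
    conditioning on the presence of one cycle does not help to avoid the others.
    Both properties are decreasing, so they transfer to a fixed number of edges,
    as does the union bound over all assignments that excludes homomorphisms. *)

Local Open Scope ring_scope.

(** Integrality is the obstacle: averaging over the extensions of a homomorphism would give rational
    solutions, whereas pushing forward along one fixed way of extending keeps the coefficients
    integral. This is why extensions must be uniform in the homomorphism. Two densities are at work.
    Sparsity holds at rate [t - 1 - 1/(2q)], closedness asks for [t - 1 - 1/q] only; the difference
    of [1/(2q)] per edge is paid for by the vertices of the set to be closed, so closures have size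
    linear in [k]. In the first moment bound, staying [1/Q] below the rate [t - 1] leaves one factor
    [f/n] for families of [f] edges, which is small for [f <= alpha n]. In the other direction,
    [q > 3 (l t + 2)] is what the degree count needs to force a path of [l] edges. The hypergraph
    estimates do not see the template, so [zeta] and [delta] depend on [t], [l] and [Delta] alone.
    That acceptance is only shown with probability [delta] comes from the short cycles, whose
    absence is bounded below by a constant. *)

Lemma pdecP (P : Prop) : reflect P (pdec P).
Proof. by rewrite /pdec; case: excluded_middle_informative => h; constructor. Qed.

Lemma functional_choice (A B : Type) (P : A -> B -> Prop) :
  (forall x, exists y, P x y) -> exists f, forall x, P x (f x).
Proof.
move=> PE; exists (fun x => proj1_sig (constructive_indefinite_description _ (PE x))).
by move=> x; case: constructive_indefinite_description.
Qed.

(** * Integral solutions from uniform extensions *)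

Section Pushforward.
Variable T : finType.
Implicit Types (u v : T -> T) (f g : {ffun T -> int}).

(** Integer functions act as signed measures on partial maps. For [u] a restriction this is the
    marginal, so the equations of [L_k] say that total masses are 1 and marginals agree. *)
Definition pushfwd u f : {ffun T -> int} :=
  [ffun y => \sum_(x | u x == y) f x].

Definition dirac_ffun (x : T) : {ffun T -> int} := [ffun y => (y == x)%:R].

Lemma pushfwd_comp u v f : pushfwd u (pushfwd v f) = pushfwd (u \o v) f.
Proof.
apply/ffunP=> z; rewrite !ffunE [RHS](partition_big v (fun y => u y == z)) //=.
apply: eq_bigr => y /eqP <-; rewrite ffunE.
by apply: eq_bigl => x; case: eqP => [->|]; rewrite ?eqxx ?andbF.
Qed.

Lemma eq_pushfwd u v f : (forall x, f x != 0 -> u x = v x) ->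
  pushfwd u f = pushfwd v f.
Proof.
move=> uv; apply/ffunP=> y; rewrite !ffunE big_mkcond [RHS]big_mkcond.
apply: eq_bigr => x _; case: (eqVneq (f x) 0) => [->|/uv -> //].
by do 2!case: ifP.
Qed.

Lemma pushfwd_id u f : (forall x, f x != 0 -> u x = x) -> pushfwd u f = f.
Proof.
move=> uf; rewrite (@eq_pushfwd u id) //; apply/ffunP=> y.
by rewrite ffunE (big_pred1 y).
Qed.

Lemma pushfwd0 u : pushfwd u 0 = 0.
Proof. by apply/ffunP=> y; rewrite !ffunE big1 // => x; rewrite ffunE. Qed.

Lemma pushfwdD u : {morph pushfwd u : f g / f + g}.
Proof.
move=> f g; apply/ffunP=> y; rewrite !ffunE -big_split.
by apply: eq_bigr => x; rewrite ffunE.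
Qed.

Lemma pushfwdN u f : pushfwd u (- f) = - pushfwd u f.
Proof.
apply/ffunP=> y; rewrite !ffunE -sumrN.
by apply: eq_bigr => x; rewrite ffunE.
Qed.

Lemma pushfwd_sum u (I : finType) (P : pred I) (F : I -> {ffun T -> int}) :
  pushfwd u (\sum_(i | P i) F i) = \sum_(i | P i) pushfwd u (F i).
Proof. exact: (big_morph _ (pushfwdD u) (pushfwd0 u)). Qed.

Lemma pushfwd_mass u f : \sum_y pushfwd u f y = \sum_x f x.
Proof.
rewrite [RHS](partition_big u xpredT) //=.
by apply: eq_bigr => y _; rewrite ffunE.
Qed.

Lemma pushfwd_supp u f y : pushfwd u f y != 0 -> exists2 x, f x != 0 & u x = y.
Proof.
rewrite ffunE => ny; apply: Classical_Prop.NNPP => nex; move/eqP: ny; apply.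
rewrite big1 // => x /eqP uxy; apply/eqP; apply: Classical_Prop.NNPP => /negP fx0.
by apply: nex; exists x.
Qed.

Lemma pushfwd_dirac u x : pushfwd u (dirac_ffun x) = dirac_ffun (u x).
Proof.
apply/ffunP=> y; rewrite !ffunE [y == _]eq_sym.
case: eqP => [uxy|nuxy].
  rewrite (bigD1 x) ?uxy ?eqxx //= ffunE eqxx big1 ?addr0 // => z /andP[_ /negPf zx].
  by rewrite ffunE zx.
rewrite big1 // => z /eqP uz; rewrite ffunE; case: eqP => // zx.
by rewrite -zx uz in nuxy.
Qed.

End Pushforward.

(** * Compatible families of integer chains and the run of the algorithm *)

Section LocalToGlobal.
Variables (t s n : nat) (D : finType) (RA : 'I_s -> {set t.-tuple 'I_n}).
Variable RT : 'I_s -> {set t.-tuple D}.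
Local Notation pmapD := (Defs.pmap n D).
Local Notation hom := (homX RA RT).
Implicit Types (X Y Z : {set 'I_n}) (phi psi : pmapD).

Definition glue X Z (h : 'I_n -> D) phi : pmapD :=
  [ffun x => if x \in Z then phi x else if x \in X then Some (h x) else None].

Lemma restr_restr Y X phi : restr Y (restr X phi) = restr (Y :&: X) phi.
Proof. by apply/ffunP=> x; rewrite !ffunE inE; case: (x \in Y). Qed.

Lemma restr_sub Y X phi : Y \subset X -> restr Y (restr X phi) = restr Y phi.
Proof. by move=> /setIidPl YX; rewrite restr_restr YX. Qed.

Lemma hom_dom X phi : phi \in hom X -> forall x, (phi x != None) = (x \in X).
Proof. by rewrite inE => /andP[/eqP <- _] x; rewrite inE. Qed.

Lemma restr_id X Y phi : phi \in hom X -> X \subset Y -> restr Y phi = phi.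
Proof.
move=> hphi XY; apply/ffunP=> x; rewrite ffunE; case: ifP => // xY.
case: (phi x =P None) => [->//|/eqP]; rewrite (hom_dom hphi) => /(subsetP XY).
by rewrite xY.
Qed.

Lemma restr_hom X Y phi : phi \in hom X -> Y \subset X -> restr Y phi \in hom Y.
Proof.
move=> hphi YX; have dom := hom_dom hphi; move: hphi.
rewrite !inE => /andP[_ /forallP hh]; apply/andP; split.
  apply/eqP/setP=> x; rewrite inE ffunE; case: (boolP (x \in Y)) => // xY.
  by rewrite dom (subsetP YX).
apply/forallP=> G; apply/forall_inP=> tu tuG; apply/implyP=> /allP tuY.
have /implyP := forall_inP (hh G) tu tuG.
have -> : all (fun x => x \in X) tu.
  by apply/allP=> x /tuY; apply: subsetP.
move=> /(_ isT) /exists_inP[u uG /eqP uE]; apply/exists_inP; exists u => //.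
apply/eqP; rewrite uE; apply/eq_in_map => x /tuY xY.
by rewrite ffunE xY.
Qed.

Lemma hom_set0 : (0 < t)%N -> [ffun=> None] \in hom set0.
Proof.
move=> t0; rewrite inE; apply/andP; split.
  by apply/eqP/setP=> x; rewrite !inE ffunE.
apply/forallP=> G; apply/forall_inP=> -[[|x tu] tut] _; last by rewrite /= inE.
by exfalso; move: t0; rewrite -(eqP tut).
Qed.

Lemma restr_glue X Z h phi : phi \in hom Z -> Z \subset X ->
  restr Z (glue X Z h phi) = phi.
Proof.
move=> hphi ZX; apply/ffunP=> x; rewrite !ffunE.
case: ifP => [->//|xZ]; apply/esym.
by case: (phi x =P None) => // /eqP; rewrite (hom_dom hphi) xZ.
Qed.

Definition chain := {ffun pmapD -> int}.

Definition hom_chain X (f : chain) := forall phi, f phi != 0 -> phi \in hom X.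

Lemma hom_chain_restr X Y f : Y \subset X -> hom_chain X f ->
  hom_chain Y (pushfwd (restr Y) f).
Proof. by move=> YX fX psi /pushfwd_supp[phi /fX hphi <-]; exact: restr_hom hphi YX. Qed.

Lemma hom_chain0 X : hom_chain X 0.
Proof. by move=> phi; rewrite ffunE eqxx. Qed.

Lemma hom_chainD X f g : hom_chain X f -> hom_chain X g -> hom_chain X (f + g).
Proof.
move=> fX gX phi; rewrite ffunE; case: (eqVneq (f phi) 0) => [->|/fX //].
by rewrite add0r => /gX.
Qed.

Lemma hom_chainN X f : hom_chain X f -> hom_chain X (- f).
Proof. by move=> fX phi; rewrite ffunE oppr_eq0 => /fX. Qed.

Lemma hom_chain_sum X (I : finType) (P : pred I) (F : I -> chain) :
  (forall i, P i -> hom_chain X (F i)) -> hom_chain X (\sum_(i | P i) F i).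
Proof. by move=> FX; elim/big_ind: _ => //; [apply: hom_chain0|apply: hom_chainD]. Qed.

Variables (k : nat) (C : {pred {set 'I_n}}).
Hypothesis t_gt0 : (0 < t)%N.
Hypothesis C_set0 : set0 \in C.
Hypothesis C_setI : forall X Y, X \in C -> Y \in C -> X :&: Y \in C.
Hypothesis C_cover : forall X, (#|X| <= k)%N -> exists2 Y, Y \in C & X \subset Y.
(* That [h] does not depend on [phi] is what makes each correction in
   [extend_compatible] vanish on the sets treated before. *)
Hypothesis C_ext : forall X Z, X \in C -> Z \in C -> Z \subset X ->
  exists h : 'I_n -> D, forall phi, phi \in hom Z -> glue X Z h phi \in hom X.

(** [P] is tested on the larger set only, since the predicates in use pass to subsets. *)
Definition compatible (P : pred {set 'I_n}) (c : {set 'I_n} -> chain) :=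
  (forall Z, Z \in C -> P Z -> hom_chain Z (c Z)) /\
  (forall Z Z', Z \in C -> Z' \in C -> P Z -> Z' \subset Z ->
     pushfwd (restr Z') (c Z) = c Z').

(** The marginals are corrected on closed sets of one size [j] after the other. By then the defect
    [d Z] of a set of size [j] vanishes on its smaller closed subsets, so gluing it with a fixed
    outer assignment repairs [Z] and changes no marginal on another closed set of size at most
    [j]. *)
Lemma extend_compatible X c : X \in C -> compatible (fun Z => Z \proper X) c ->
  exists r, hom_chain X r /\
    forall Z, Z \in C -> Z \proper X -> pushfwd (restr Z) r = c Z.
Proof.
move=> XC [chom ccomp].
have: forall j : nat, exists r, hom_chain X r /\
    forall Z, Z \in C -> Z \proper X -> (#|Z| < j)%N -> pushfwd (restr Z) r = c Z.
  elim=> [|j [r [rX rc]]].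
    by exists 0; split=> [|//]; apply: hom_chain0.
  have /functional_choice[h hE] : forall Z, exists hZ, Z \in C -> Z \subset X ->
      forall phi, phi \in hom Z -> glue X Z hZ phi \in hom X.
    move=> Z.
    case: (boolP ((Z \in C) && (Z \subset X))) => [/andP[ZC ZX]|nZ].
      by have [h hE] := C_ext XC ZC ZX; exists h.
    have [h _] := C_ext XC XC (subxx X).
    by exists h => ZC ZX; rewrite ZC ZX in nZ.
  pose d Z : chain := c Z - pushfwd (restr Z) r.
  have dhom Z : Z \in C -> Z \proper X -> hom_chain Z (d Z).
    move=> ZC ZX; apply: hom_chainD; first exact: chom.
    by apply/hom_chainN/(hom_chain_restr _ rX); rewrite proper_sub.
  have d0 Z Z' : Z \in C -> Z \proper X -> (#|Z| = j)%N -> Z' \in C ->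
      (#|Z' :&: Z| < j)%N -> pushfwd (restr (Z' :&: Z)) (d Z) = 0.
    move=> ZC ZX Zj Z'C lt; rewrite pushfwdD pushfwdN pushfwd_comp.
    rewrite (ccomp Z) ?C_setI ?subsetIr //.
    rewrite (@eq_pushfwd _ _ (restr (Z' :&: Z))); last first.
      by move=> phi _; rewrite /= restr_sub ?subsetIr.
    rewrite rc ?subrr ?C_setI //; apply: sub_proper_trans ZX; exact: subsetIr.
  pose G Z := pushfwd (glue X Z (h Z)) (d Z).
  pose S := \sum_(Z | [&& Z \in C, Z \proper X & #|Z| == j]) G Z.
  exists (r + S); split.
    apply: hom_chainD => //; apply: hom_chain_sum => Z /and3P[ZC ZX _] psi.
    case/pushfwd_supp=> phi /(dhom _ ZC ZX) hphi <-.
    by apply: hE; rewrite ?proper_sub.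
  move=> Z' Z'C Z'X; rewrite ltnS leq_eqVlt => Z'j.
  have GZ Z : Z \in C -> Z \proper X -> #|Z| == j -> Z != Z' ->
      pushfwd (restr Z') (G Z) = 0.
    move=> ZC ZX /eqP Zj ZZ'; have lt : (#|Z' :&: Z| < j)%N.
      rewrite -Zj ltn_neqAle subset_leq_card ?subsetIr // andbT.
      apply: contra ZZ' => /eqP e.
      have ZZ' : Z \subset Z'.
        by apply/setIidPr/eqP; rewrite eqEcard subsetIr /= e.
      by rewrite eqEcard ZZ' Zj /=; case/orP: Z'j => [/eqP->|/ltnW].
    (* As the values glued outside [Z] are fixed, gluing and then restricting to [Z'] factors
       through the restriction to [Z' :&: Z], where the defect is zero. *)
    pose w (phi : pmapD) : pmapD := [ffun x => if x \in Z' then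
      (if x \in Z then phi x else Some (h Z x)) else None].
    rewrite /G pushfwd_comp (@eq_pushfwd _ _ (w \o restr (Z' :&: Z))); last first.
      move=> phi _; apply/ffunP=> x; rewrite !ffunE; case: ifP => // xZ'.
      rewrite inE xZ' /=; case: ifP => // _.
      by rewrite (subsetP (proper_sub Z'X)).
    by rewrite -pushfwd_comp d0 // pushfwd0.
  rewrite pushfwdD pushfwd_sum; case/orP: Z'j => [Z'j|Z'j]; last first.
    rewrite rc // big1 ?addr0 // => Z /and3P[ZC ZX Zj]; apply: GZ => //.
    by apply: contraTneq Z'j => <-; rewrite (eqP Zj) ltnn.
  rewrite (bigD1 Z') /= ?Z'C ?Z'X ?Z'j // big1 ?addr0; last first.
    by move=> Z /andP[/and3P[ZC ZX Zj] ZZ']; apply: GZ.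
  rewrite /G pushfwd_comp [pushfwd (_ \o _) _]pushfwd_id; first by rewrite addrC; exact: subrK.
  by move=> phi /(dhom _ Z'C Z'X) hphi; apply: restr_glue; rewrite ?proper_sub.
move=> /(_ #|X|)[r [rX rc]]; exists r; split=> // Z ZC ZX.
by apply: rc => //; apply: proper_card.
Qed.

(** The Dirac chain at [phi1] determines the chains on closed subsets of [X1]. The other closed sets
    are filled in by cardinality, when all their proper closed subsets are already settled. *)
Lemma global_section X1 phi1 : X1 \in C -> phi1 \in hom X1 ->
  exists c, compatible xpredT c /\ c X1 = dirac_ffun phi1.
Proof.
move=> X1C hphi1.
have dirac_hom : hom_chain X1 (dirac_ffun phi1).
  by move=> phi; rewrite ffunE; case: (phi =P phi1) => [->|_] //; rewrite eqxx.
suff [c [cc c1]] : exists c,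
    compatible (fun Z => (Z \subset X1) || (#|Z| < n.+1)%N) c /\
    c X1 = dirac_ffun phi1.
  exists c; split=> //; case: cc => chom ccomp.
  have le Z : (Z \subset X1) || (#|Z| < n.+1)%N.
    by rewrite ltnS -[leqRHS]card_ord max_card orbT.
  by split=> [Z ZC _|Z Z' ZC Z'C _]; [apply: chom|apply: ccomp].
elim: n.+1 => [|j [c [[chom ccomp] c1]]].
  exists (fun Z => pushfwd (restr Z) (dirac_ffun phi1)); split; last first.
    by rewrite pushfwd_dirac (restr_id hphi1).
  split=> [Z ZC|Z Z' ZC Z'C]; rewrite orbF => ZX; first exact: hom_chain_restr ZX dirac_hom.
  by move=> Z'Z; rewrite pushfwd_comp; apply: eq_pushfwd => phi _; exact: restr_sub.
have /functional_choice[r rE] : forall X, exists rX, X \in C -> #|X| = j ->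
    hom_chain X rX /\
    forall Z, Z \in C -> Z \proper X -> pushfwd (restr Z) rX = c Z.
  move=> X.
  case: (boolP ((X \in C) && (#|X| == j))) => [/andP[XC /eqP Xj]|nX]; last first.
    by exists 0 => XC Xj; rewrite XC Xj eqxx in nX.
  have small Z : Z \proper X -> (Z \subset X1) || (#|Z| < j)%N.
    by move=> /proper_card; rewrite Xj => ->; rewrite orbT.
  have [|r rE] := @extend_compatible X c XC; last by exists r.
  by split=> [Z ZC /small|Z Z' ZC Z'C /small]; [apply: chom|apply: ccomp].
pose c' Z := if (Z \subset X1) || (#|Z| < j)%N then c Z else r Z.
have new Z : (Z \subset X1) || (#|Z| < j.+1)%N ->
    (Z \subset X1) || (#|Z| < j)%N = false -> #|Z| = j.
  by rewrite ltnS leq_eqVlt orbCA => /orP[/eqP //|->].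
exists c'; split; last by rewrite /c' subxx.
split=> [Z ZC PZ|Z Z' ZC Z'C PZ Z'Z]; rewrite /c'.
  by case: ifP => [|/(new _ PZ) Zj]; [apply: chom|case: (rE _ ZC Zj)].
case: ifP => [oldZ|/[dup] oldZ /(new _ PZ) Zj].
  rewrite ifT ?ccomp //; case/orP: oldZ => [ZX1|Zj].
    by rewrite (subset_trans Z'Z).
  by rewrite (leq_ltn_trans (subset_leq_card Z'Z) Zj) orbT.
have [rhom rcomp] := rE _ ZC Zj.
case: (eqVneq Z' Z) => [->|Z'neq].
  rewrite oldZ pushfwd_id // => phi /rhom hphi; exact: (restr_id hphi).
have Z'p : Z' \proper Z by rewrite properEneq Z'neq.
by rewrite rcomp // ifT // -Zj proper_card // orbT.
Qed.

(** A closed superset of least size lies in every other one, since otherwise their intersection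
    would be smaller. *)
Lemma exists_closure : exists cl : {set 'I_n} -> {set 'I_n}, forall X,
  (#|X| <= k)%N -> [/\ cl X \in C, X \subset cl X &
    forall Y, Y \in C -> X \subset Y -> cl X \subset Y].
Proof.
apply: (@functional_choice _ _ (fun X clX => (#|X| <= k)%N ->
  [/\ clX \in C, X \subset clX &
    forall Y, Y \in C -> X \subset Y -> clX \subset Y])) => X.
case: (boolP (#|X| <= k)%N) => [Xk|]; last by exists set0.
have [Y0 Y0C XY0] := C_cover Xk.
have PY0 : (Y0 \in C) && (X \subset Y0) by rewrite Y0C.
exists [arg min_(Y < Y0 | (Y \in C) && (X \subset Y)) #|Y|] => _.
case: arg_minnP => // Y1 /andP[Y1C XY1] min; split=> // Y YC XY.
apply/setIidPl/eqP; rewrite eqEcard subsetIl min // C_setI //.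
by rewrite subsetI XY1.
Qed.

Lemma subcollP (kap H : coll n D) :
  reflect (forall X, (#|X| <= k)%N -> kap X \subset H X) (subcoll k kap H).
Proof.
apply: (iffP forallP) => [h X|h X]; first by move/implyP: (h X).
by apply/implyP/h.
Qed.

Lemma sub_maxcons (kap H : coll n D) : subcoll k kap H -> consistent k kap ->
  subcoll k kap (maxcons k H).
Proof.
move=> sub cons; apply/subcollP=> X Xk; rewrite ffunE Xk.
by apply: (bigcup_sup kap); rewrite sub.
Qed.

Lemma maxcons_sub (H : coll n D) X : maxcons k H X \subset H X.
Proof.
rewrite ffunE; case: ifP => Xk; last exact: sub0set.
by apply/bigcupsP=> kap /andP[/subcollP sub _]; apply: sub.
Qed.

Lemma cstep_sub (H : coll n D) X : cstep k H X \subset H X.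
Proof.
apply: subset_trans (maxcons_sub H X); apply/subsetP=> phi.
by rewrite ffunE inE => /andP[].
Qed.

(** The total number of remaining partial maps drops in every step that changes the collection. *)
Lemma iter_cstep_stable (H : coll n D) :
  exists i, iter i.+1 (cstep k) H = iter i (cstep k) H.
Proof.
pose w (K : coll n D) := (\sum_X #|K X|)%N.
have wle K : (w (cstep k K) <= w K ?= iff (cstep k K == K))%N.
  split; first by apply: leq_sum => X _; exact/subset_leq_card/cstep_sub.
  apply/eqP/eqP=> [e|->//]; apply/ffunP=> X; apply/eqP.
  rewrite eqEcard cstep_sub /=; move: e.
  rewrite /w [RHS](bigD1 X) // [LHS](bigD1 X) //= => e.
  rewrite leqNgt; apply/negP=> lt; move/eqP: e; rewrite ltn_eqF //.
  rewrite -addSn leq_add // leq_sum // => Y _; exact/subset_leq_card/cstep_sub.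
elim: {H}(w H) {-2}H (leqnn (w H)) => [|m IH] H wH.
  exists 0%N; apply/eqP; rewrite -(wle H).2 /=; move: (wle H).1 wH.
  by rewrite leqn0 => + /eqP w0; rewrite w0 leqn0.
case: (eqVneq (cstep k H) H) => [e|ne]; first by exists 0%N.
have lt : (w (cstep k H) <= m)%N.
  by rewrite -ltnS; apply: leq_trans wH; rewrite (ltn_leqif (wle H)).
by have [i iE] := IH _ lt; exists i.+1; rewrite iterSr iE -iterSr.
Qed.

Lemma cohom_accepts_local : cohom_accepts RA RT k.
Proof.
have [cl clE] := exists_closure.
pose kap : coll n D :=
  [ffun X : {set 'I_n} => if (#|X| <= k)%N then [set restr X phi | phi in hom (cl X)] else set0].
have kapP X phi : (#|X| <= k)%N ->
    reflect (exists2 phi', phi' \in hom (cl X) & phi = restr X phi') (phi \in kap X).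
  by move=> Xk; rewrite ffunE Xk; apply: imsetP.
have cl_mono X Y : (#|X| <= k)%N -> Y \subset X -> cl Y \subset cl X.
  move=> Xk YX; have Yk := leq_trans (subset_leq_card YX) Xk.
  have [_ _ mn] := clE _ Yk; have [XC Xcl _] := clE _ Xk.
  by apply: mn; rewrite // (subset_trans YX).
have kap_cons : consistent k kap.
  apply/forallP=> X; apply/forallP=> Y; apply/implyP=> /andP[Xk YX].
  have Yk := leq_trans (subset_leq_card YX) Xk.
  have [XC Xcl _] := clE _ Xk; have [YC Ycl _] := clE _ Yk.
  have clYX := cl_mono _ _ Xk YX.
  apply/andP; split; apply/forall_inP=> phi.
    case/(kapP _ _ Yk) => phi' hphi' ->; have [h hE] := C_ext XC YC clYX.
    apply/exists_inP; exists (restr X (glue (cl X) (cl Y) h phi')).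
      by apply/(kapP _ _ Xk); exists (glue (cl X) (cl Y) h phi'); rewrite ?hE.
    by rewrite restr_sub // -(restr_sub _ Ycl) restr_glue.
  case/(kapP _ _ Xk) => phi' hphi' ->; apply/(kapP _ _ Yk).
  exists (restr (cl Y) phi'); first exact: restr_hom hphi' clYX.
  by rewrite !restr_sub.
have kap_init : subcoll k kap (cinit RA RT k).
  apply/subcollP=> X Xk; apply/subsetP=> phi /(kapP _ _ Xk)[phi' hphi' ->].
  by rewrite ffunE Xk; apply: restr_hom hphi' _; case: (clE _ Xk).
(* The algorithm solves the system for its current collection, which is only known to contain [kap].
   The solution built here is supported on [kap], so the further variables are zero. *)
have kap_Lk H X phi : subcoll k kap H -> (#|X| <= k)%N -> phi \in kap X ->
    Lk_solvable k H X phi.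
  move=> /subcollP sub Xk /(kapP _ _ Xk)[phi1 hphi1 phiE].
  have [XC Xcl _] := clE _ Xk.
  have [c [[chom ccomp] c1]] := global_section XC hphi1.
  pose z Y := pushfwd (restr Y) (c (cl Y)).
  have zsupp Y psi : (#|Y| <= k)%N -> z Y psi != 0 -> psi \in kap Y.
    move=> Yk /pushfwd_supp[psi' cpsi' <-]; have [YC _ _] := clE _ Yk.
    by apply/(kapP _ _ Yk); exists psi' => //; apply: (chom _ YC).
  have zX : z X = dirac_ffun phi by rewrite /z c1 pushfwd_dirac -phiE.
  exists (fun Y psi => z Y psi); split=> [Y Yk|].
    have [YC _ _] := clE _ Yk.
    transitivity (\sum_psi z Y psi).
      rewrite big_mkcond; apply: eq_bigr => psi _; case: ifPn => // npsi.
      apply/esym/eqP; apply: contraNT npsi => /(zsupp _ _ Yk).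
      exact: (subsetP (sub _ Yk)).
    (* The masses on all closures are compared on the common closed subset [set0]; on [cl X] the
       chain is a Dirac chain, of mass 1. *)
    rewrite pushfwd_mass -(pushfwd_mass (restr set0)).
    rewrite (ccomp _ set0) ?sub0set // -(ccomp _ set0 XC) ?sub0set // c1.
    rewrite pushfwd_mass (bigD1 phi1) //= big1 ?addr0 ?ffunE ?eqxx //.
    by move=> psi /negPf npsi; rewrite ffunE npsi.
  split=> [Y Z Yk ZY psi _|].
    have Zk := leq_trans (subset_leq_card ZY) Yk.
    have [YC Ycl _] := clE _ Yk; have [ZC Zcl _] := clE _ Zk.
    transitivity (pushfwd (restr Z) (z Y) psi).
      rewrite ffunE big_mkcondl; apply: eq_bigr => phi' _; case: ifPn => // npsi.
      apply/esym/eqP; apply: contraNT npsi => /(zsupp _ _ Yk).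
      exact: (subsetP (sub _ Yk)).
    suff -> : pushfwd (restr Z) (z Y) = z Z by [].
    rewrite /z -(ccomp (cl Y) (cl Z)) ?cl_mono // !pushfwd_comp.
    by apply: eq_pushfwd => phi' _; rewrite /= !restr_sub.
  rewrite zX; split; first by rewrite ffunE eqxx.
  by move=> psi _ /negPf npsi; rewrite ffunE npsi.
have kap_step H : subcoll k kap H -> subcoll k kap (cstep k H).
  move=> sub; have sub' := sub_maxcons sub kap_cons.
  apply/subcollP=> X Xk; apply/subsetP=> phi phik; rewrite ffunE inE.
  rewrite (subsetP (subcollP _ _ sub' _ Xk)) //=.
  by apply/pdecP/kap_Lk.
have kap_iter i : subcoll k kap (iter i (cstep k) (cinit RA RT k)).
  by elim: i => [|i IH] //=; apply: kap_step.
have [i iE] := iter_cstep_stable (cinit RA RT k).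
exists i; split=> // X Xk; have [XC Xcl _] := clE _ Xk.
have [h hE] := C_ext XC C_set0 (sub0set _).
apply/set0Pn; exists (restr X (glue (cl X) set0 h [ffun=> None])).
apply: (subsetP (subcollP _ _ (kap_iter i) _ Xk)).
by apply/(kapP _ _ Xk); eexists; first exact: hE (hom_set0 t_gt0).
Qed.

End LocalToGlobal.

(** * Sparse hypergraphs without short cycles *)

Local Open Scope nat_scope.

Section Hypergraph.
Variable V : finType.
Implicit Types (x y : V) (E F : {set {set V}}) (Z : {set V}).

(** Only consecutive vertices have to differ, so this is a closed walk with distinct edges. For
    [j = 2] it means two edges with two common vertices. *)
Definition is_cycle E (j : nat) (v : nat -> V) (f : nat -> {set V}) :=
  [/\ {in gtn j &, injective f}, forall i, i < j -> f i \in E,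
      forall i, i < j -> [/\ v i \in f i, v i.+1 \in f i & v i != v i.+1]
    & v j = v 0].

Definition no_short_cycle (l : nat) E :=
  forall j v f, 1 < j <= l -> ~ is_cycle E j v f.

Lemma no_short_cycleS l E F : F \subset E -> no_short_cycle l E -> no_short_cycle l F.
Proof.
move=> FE nc j v f jl [fi fF vf vj]; apply: (nc j v f jl); split=> // i ij.
exact/(subsetP FE)/fF.
Qed.

Definition is_walk F (l : nat) (v : nat -> V) (e : nat -> {set V}) :=
  [/\ forall i, i < l -> e i \in F,
      forall i, i < l -> [/\ v i \in e i, v i.+1 \in e i & v i != v i.+1],
      forall i, i.+1 < l -> e i != e i.+1
    & forall i f, i.+1 < l -> f \in F -> v i.+1 \in f -> f = e i \/ f = e i.+1].

(** A repeated edge, taken at its first return, or a repeated vertex would close a cycle with at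
    most [l] edges. *)
Lemma walk_inj F l v e : is_walk F l v e -> no_short_cycle l F ->
  {in gtn l &, injective e} /\ {in geq l &, injective v}.
Proof.
move=> [eF ve ee only] nc.
have einj j : j <= l -> forall i i', i < i' -> i' < j -> e i <> e i'.
  elim: j => [//|j IH] jl i i' ii'; rewrite ltnS leq_eqVlt => /orP[/eqP i'j|]; last first.
    exact: IH (ltnW jl) _ _ ii'.
  rewrite {}i'j {i'} in ii' * => eij.
  have {}IH := IH (ltnW jl).
  have IH' a b : a < j -> b < j -> e a = e b -> a = b.
    by move=> aj bj eab; case: (ltngtP a b) => // ab; case: (IH _ _ ab).
  have ij : i.+1 < j.
    rewrite ltn_neqAle ii' andbT; apply/eqP=> ij; rewrite -ij in eij jl.
    by move: (ee i jl); rewrite eij eqxx.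
  have [vj vj1 _] := ve _ jl.
  (* Since [e i = e j] contains [v j], the edge [e i] closes the walk from [v i.+1] to [v j]; hence
     the start is [v j] in place of [v i]. The degree condition at [v i.+1] ensures that the two
     ends differ. *)
  apply: (nc (j - i) (fun k => if k == 0 then v j else v (i + k)) (fun k => e (i + k))).
    lia.
  split.
  - by move=> a b; rewrite !inE => aj bj /IH' ab; lia.
  - by move=> k kj; apply: eF; lia.
  - case=> [|k] kj; last by rewrite /= !addnS; apply: ve; lia.
    rewrite /= addn1 addn0; have [_ vi1 _] := ve i ltac:(lia).
    split; [by rewrite eij| done |]; apply/eqP=> vji.
    have [_ vjj _] := ve j.-1 ltac:(lia).
    have jS : j.-1.+1 = j by lia.
    rewrite jS vji in vjj; case: (only i _ ltac:(lia) (eF j.-1 ltac:(lia)) vjj).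
      by move/IH' => h; lia.
    move/IH' => h; have ji : j = i.+2 by lia.
    have [_ _ +] := ve i.+1 ltac:(lia); by rewrite -ji vji eqxx.
  - by rewrite ifF ?subnKC // ?(ltnW ii'); lia.
have {}einj : {in gtn l &, injective e}.
  move=> a b; rewrite !inE => al bl eab.
  by case: (ltngtP a b) => // ab; case: (einj l (leqnn l) _ _ ab).
split=> //.
have vneq i j : i < j -> j <= l -> v i <> v j.
  move=> ij jl vij; have [_ _ vi1] := ve i (leq_trans ij jl).
  have ij2 : i.+1 < j.
    rewrite ltn_neqAle ij andbT; apply/eqP=> e1.
    by rewrite e1 vij eqxx in vi1.
  apply: (nc (j - i) (fun k => v (i + k)) (fun k => e (i + k))); first lia.
  split=> [a b|k kj|k kj|]; rewrite ?addnS ?addn0.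
  - by rewrite !inE => aj bj /einj; rewrite !inE => h; lia.
  - by apply: eF; lia.
  - by apply: ve; lia.
  - by rewrite subnKC // ltnW.
move=> a b; rewrite !inE => al bl vab.
by case: (ltngtP a b) => // ab; case: (vneq _ _ ab).
Qed.

(** * Degree counting and paths through vertices of degree two *)

Section Degrees.
Variables (F : {set {set V}}) (Z : {set V}).

Definition degree y := #|[set e in F | y \in e]|.

Definition shared (e : {set V}) : {set V} :=
  [set y in e | (y \in Z) || (1 < degree y)].

(** A walk that enters such an edge at one shared vertex can leave it only by the other, and there
    meets exactly one further edge. *)
Definition good_edge (e : {set V}) :=
  [&& e \in F, #|shared e| == 2 &
      [forall y in shared e, (y \notin Z) && (degree y == 2)]].

Lemma degree_gt0 e y : e \in F -> y \in e -> 0 < degree y.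
Proof. by move=> eF ye; apply/card_gt0P; exists e; rewrite inE eF. Qed.

Lemma degree1P e e' y : degree y <= 1 -> e \in F -> e' \in F -> y \in e ->
  y \in e' -> e = e'.
Proof.
by move=> /card_le1_eqP d eF e'F ye ye'; apply: d; rewrite inE ?eF ?e'F.
Qed.

Lemma degree_gt1 e e' y : e \in F -> e' \in F -> y \in e -> y \in e' ->
  e != e' -> 1 < degree y.
Proof.
move=> eF e'F ye ye' ee'; rewrite ltnNge; apply: contra ee' => d.
by apply/eqP/(degree1P d).
Qed.

(* A vertex outside [Z] gives weight 6, 3 or 2 to each of its edges according to
   its degree, hence at least 6 in total, while a bad edge receives at most
   [6 (t - 1) - 1]. *)
Lemma card_bad_edges t : (forall e, e \in F -> #|e| = t) ->
  (forall e, e \in F -> 1 < #|shared e|) ->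
  6 * #|cover F :\: Z| + #|[set e in F | ~~ good_edge e]| <= 6 * (t - 1) * #|F|.
Proof.
move=> Ft Fsh.
pose c y := if y \in Z then 0 else if degree y == 1 then 6 else
            if degree y == 2 then 3 else 2.
have le_c : 6 * #|cover F :\: Z| <= \sum_(e in F) \sum_(y in e) c y.
  have -> : \sum_(e in F) \sum_(y in e) c y = \sum_(y in cover F) degree y * c y.
    rewrite (exchange_big_dep (mem (cover F))) /=; last first.
      by move=> e y eF ye; apply/bigcupP; exists e.
    by apply: eq_bigr => y _; rewrite sum_nat_cond_const.
  rewrite (big_setID Z) /= mulnC -sum_nat_const; apply: leq_trans (leq_addl _ _).
  apply: leq_sum => y; rewrite inE /c => /andP[/negPf -> /bigcupP[e eF ye]].
  move: (degree_gt0 eF ye); case: eqP => [->//|]; case: eqP => [->//|]; lia.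
have -> : #|[set e in F | ~~ good_edge e]| = \sum_(e in F) ~~ good_edge e.
  by rewrite -sum1dep_card big_mkcondr; apply: eq_bigr => e _; case: good_edge.
apply: (leq_trans (leq_add le_c (leqnn _))); rewrite -big_split /= mulnC -sum_nat_const.
apply: leq_sum => e eF.
have csh y : y \in e -> c y + 3 * (y \in shared e) <= 6.
  rewrite inE /c => ye; rewrite ye /=; have := degree_gt0 eF ye.
  case: (y \in Z) => //=; case: (degree y) => [|[|[|d]]] //=.
have sum_sh : \sum_(y in e) 3 * (y \in shared e) = 3 * #|shared e|.
  rewrite -big_distrr /= -sum1_card; congr (3 * _).
  rewrite [RHS]big_mkcond [LHS]big_mkcond /=; apply: eq_bigr => y _.
  by rewrite inE; case: (y \in e); case: (_ || _).
have sum_c : \sum_(y in e) c y + 3 * #|shared e| <= 6 * t.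
  rewrite -sum_sh -big_split /= -(Ft e eF) mulnC -sum_nat_const.
  exact: leq_sum.
have := Fsh e eF; rewrite leq_eqVlt => /orP[/eqP sh2|sh3]; last first.
  by case: (good_edge e) => /=; lia.
case: (boolP (good_edge e)) => [_|] /=; first lia.
rewrite /good_edge eF -sh2 eqxx /= negb_forall => /existsP[y].
rewrite negb_imply => /andP[ysh ny].
have ye : y \in e by move: ysh; rewrite inE => /andP[].
have cy : c y + 3 * (y \in shared e) <= 5.
  rewrite ysh /c; move: ysh ny; rewrite inE ye /=.
  by case: (y \in Z) => //=; case: (degree y) => [|[|[|d]]].
have et : #|e :\ y| = t - 1 by have := cardsD1 y e; rewrite ye Ft //; lia.
have : \sum_(y in e) (c y + 3 * (y \in shared e)) <= 5 + 6 * (t - 1).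
  rewrite (big_setD1 y) //= leq_add // -et mulnC -sum_nat_const.
  by apply: leq_sum => z; rewrite inE => /andP[_ /csh].
have t0 : 0 < t by rewrite -(Ft e eF); apply/card_gt0P; exists y.
by rewrite big_split /= sum_sh -sh2; lia.
Qed.

Lemma good_edgeP e : good_edge e -> e \in F /\ #|shared e| = 2.
Proof. by case/and3P=> -> /eqP. Qed.

Lemma good_edge_shared e y : good_edge e -> y \in shared e ->
  [/\ y \in e, y \notin Z & degree y = 2].
Proof.
case/and3P=> _ _ /forall_inP h ysh; have /andP[yZ /eqP d] := h _ ysh.
by split=> //; move: ysh; rewrite inE => /andP[].
Qed.

Definition other_edge (e : {set V}) y :=
  odflt e [pick f in F | (y \in f) && (f != e)].

Definition other_end (e : {set V}) y :=
  odflt y [pick x in shared e | x != y].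

Lemma other_endP e y : good_edge e -> y \in shared e ->
  [/\ other_end e y \in shared e, other_end e y != y
    & shared e = [set y; other_end e y]].
Proof.
move=> /good_edgeP[_ sh2] ysh; rewrite /other_end.
case: pickP => [x /andP[xsh xy]|no] /=; last first.
  have := cardsD1 y (shared e); rewrite ysh sh2.
  rewrite (_ : shared e :\ y = set0) ?cards0 //.
  by apply/setP=> x; rewrite !inE andbC; have := no x; rewrite !inE.
split=> //; apply/esym/eqP; rewrite eqEcard sh2 cards2 eq_sym xy andbT.
by rewrite subUset !sub1set ysh.
Qed.

Lemma other_endK e y : good_edge e -> y \in shared e ->
  other_end e (other_end e y) = y.
Proof.
move=> ge ysh; have [osh oy _] := other_endP ge ysh.
have [_ ooy shE] := other_endP ge osh.
by move: ysh; rewrite shE !inE => /orP[] /eqP // y1; rewrite -y1 eqxx in oy.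
Qed.

Lemma other_edgeP e y : e \in F -> y \in e -> degree y = 2 ->
  [/\ other_edge e y \in F, y \in other_edge e y, other_edge e y != e
    & forall f, f \in F -> y \in f -> f = e \/ f = other_edge e y].
Proof.
move=> eF ye d2; rewrite /other_edge; case: pickP => [f /and3P[fF yf fe]|no] /=.
  split=> // g gF yg; have : [set g in F | y \in g] = [set e; f].
    apply/esym/eqP; rewrite eqEcard [X in X <= _]d2 cards2 eq_sym fe andbT.
    by apply/subsetP=> h; rewrite !inE => /orP[] /eqP ->; apply/andP.
  by move/setP/(_ g); rewrite !inE gF yg => /esym/orP[] /eqP; [left|right].
suff : degree y <= 1 by rewrite d2.
rewrite -(cards1 e); apply/subset_leq_card/subsetP=> f; rewrite !inE => /andP[fF yf].
by have := no f; rewrite fF yf => /negbFE.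
Qed.

Lemma other_edgeK e y : e \in F -> y \in e -> degree y = 2 ->
  other_edge (other_edge e y) y = e.
Proof.
move=> eF ye d2; have [oF yo oe only] := other_edgeP eF ye d2.
have [ooF yoo oo _] := other_edgeP oF yo d2.
by case: (only _ ooF yoo) => // h; rewrite h eqxx in oo.
Qed.

(** An edge with its exit vertex: a good edge has two darts, one for each direction of traversal. *)
Definition dart := ({set V} * V)%type.
Definition good_darts : {set dart} :=
  [set d | good_edge d.1 && (d.2 \in shared d.1)].

Definition next_dart (d : dart) : dart :=
  let e := other_edge d.1 d.2 in (e, other_end e d.2).

Fixpoint long_darts r : {set dart} :=
  if r is r'.+1 then [set d in good_darts | next_dart d \in long_darts r']
  else good_darts.

Lemma card_dep (P : pred {set V}) (f : {set V} -> {set V}) :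
  #|[set d : dart | P d.1 && (d.2 \in f d.1)]| = \sum_(e | P e) #|f e|.
Proof.
rewrite -sum1dep_card -(pair_big_dep P (fun e y => y \in f e) (fun _ _ => 1)) /=.
by apply: eq_bigr => e _; rewrite sum1_card.
Qed.

Lemma good_dartP d : d \in good_darts ->
  [/\ good_edge d.1, d.2 \in shared d.1, d.1 \in F, d.2 \in d.1
    & degree d.2 = 2].
Proof.
rewrite inE => /andP[gd sd]; have [ed eZ d2] := good_edge_shared gd sd.
by have [dF _] := good_edgeP gd; split.
Qed.

Lemma next_dart_good d : d \in good_darts -> good_edge (other_edge d.1 d.2) ->
  next_dart d \in good_darts.
Proof.
move=> /good_dartP[gd sd dF ed d2] go.
have [oF yo _ _] := other_edgeP dF ed d2.
have ysh : d.2 \in shared (other_edge d.1 d.2) by rewrite inE yo d2 orbT.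
by have [osh _ _] := other_endP go ysh; rewrite inE go.
Qed.

(** Steps can be reversed. Darts whose next edge is bad therefore inject into pairs of a bad edge
    and a vertex on it, [t] per bad edge, while darts that fail later inject through [next_dart]
    into those that fail within [r] steps. *)
Lemma card_short_darts t r : (forall e, e \in F -> #|e| = t) ->
  #|good_darts :\: long_darts r| <= r * (t * #|[set e in F | ~~ good_edge e]|).
Proof.
move=> Ft; elim: r => [|r IH]; first by rewrite setDv cards0.
pose T := [set d in good_darts | ~~ good_edge (other_edge d.1 d.2)].
pose S := [set d in good_darts |
  good_edge (other_edge d.1 d.2) && (next_dart d \notin long_darts r)].
have sub : good_darts :\: long_darts r.+1 \subset T :|: S.
  apply/subsetP=> d; rewrite !inE => /andP[+ gd]; rewrite gd /=.
  by case: good_edge.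
apply: leq_trans (subset_leq_card sub) _; rewrite cardsU mulSn.
apply: leq_trans (leq_subr _ _) _; apply: leq_add.
  pose B := [set d : dart | (d.1 \in [set e in F | ~~ good_edge e]) && (d.2 \in d.1)].
  have -> : t * #|[set e in F | ~~ good_edge e]| = #|B|.
    rewrite /B (card_dep (mem [set e in F | ~~ good_edge e]) id) mulnC -sum_nat_const.
    apply: eq_bigr => e.
    by rewrite inE => /andP[/Ft].
  have inj : {in T &, injective (fun d => (other_edge d.1 d.2, d.2))}.
    move=> [e y] [e' y']; rewrite [in X in X -> _]inE [in X in _ -> X -> _]inE.
    move=> /andP[/good_dartP[/= _ _ eF ye d2] _] /andP[/good_dartP[/= _ _ eF' ye' d2'] _].
    move=> [oo yy].
    by rewrite -(other_edgeK eF ye d2) -(other_edgeK eF' ye' d2') oo yy.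
  rewrite -(card_in_imset inj); apply/subset_leq_card/subsetP=> _ /imsetP[d dT ->].
  move: dT; rewrite [d \in T]inE => /andP[/good_dartP[gd sd dF ed d2] ng].
  have [oF yo _ _] := other_edgeP dF ed d2.
  by rewrite !inE /= oF ng yo.
apply: leq_trans IH; have inj : {in S &, injective next_dart}.
  have back d : d \in S -> d = (other_edge (next_dart d).1
       (other_end (next_dart d).1 (next_dart d).2),
     other_end (next_dart d).1 (next_dart d).2).
    rewrite [d \in S]inE => /and3P[/good_dartP[gd sd dF ed d2] go _].
    have [oF yo _ _] := other_edgeP dF ed d2.
    have ysh : d.2 \in shared (other_edge d.1 d.2) by rewrite inE yo d2 orbT.
    by rewrite /= other_endK // other_edgeK // -surjective_pairing.
  by move=> d d' dS d'S dd; rewrite (back _ dS) (back _ d'S) dd.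
rewrite -(card_in_imset inj); apply/subset_leq_card/subsetP=> _ /imsetP[d dS ->].
move: dS; rewrite [d \in S]inE => /and3P[gd go nl].
by rewrite inE nl next_dart_good.
Qed.

(** With [B] bad edges, the weight count and the density give [q B <= 6 |F|]. If none of the
    [2 (|F| - B)] good darts were long, then [2 |F| <= (l t + 2) B], which contradicts
    [3 (l t + 2) < q]. *)
Lemma exists_good_walk t l q : 0 < l -> (forall e, e \in F -> #|e| = t) ->
  (forall e, e \in F -> 1 < #|shared e|) -> F != set0 ->
  3 * (l * t + 2) < q -> (q * (t - 1) - 1) * #|F| <= q * #|cover F :\: Z| ->
  exists v e, is_walk F l v e /\ forall i, i < l ->
    good_edge (e i) /\ shared (e i) = [set v i; v i.+1].
Proof.
move=> l0 Ft Fsh F0 ql dense.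
have bad := card_bad_edges Ft Fsh.
set B := #|[set e in F | ~~ good_edge e]| in bad.
have F_gt0 : 0 < #|F| by rewrite card_gt0.
have FB : #|[set e in F | good_edge e]| + B = #|F|.
  rewrite /B -(cardsID [set e | good_edge e] F).
  by congr addn; apply: eq_card => e; rewrite !inE // andbC.
have G2 : #|good_darts| = #|[set e in F | good_edge e]| * 2.
  rewrite (card_dep good_edge shared) -sum_nat_const; apply: eq_big => e; last by case/good_edgeP.
  by rewrite inE; case: (boolP (good_edge e)) => [/good_edgeP[->]|]; rewrite ?andbF.
have short := card_short_darts l.-1 Ft.
rewrite -/B in short.
have /set0Pn[d dl] : long_darts l.-1 != set0.
  apply/eqP=> L0; move: short; rewrite L0 setD0 G2 => short.
  have qB : q * B <= 6 * #|F|.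
    have : q * (6 * #|cover F :\: Z| + B) <= q * (6 * (t - 1) * #|F|).
      by rewrite leq_mul2l bad orbT.
    have : 6 * ((q * (t - 1) - 1) * #|F|) <= 6 * (q * #|cover F :\: Z|).
      by rewrite leq_mul2l dense orbT.
    by nia.
  have h1 : 2 * #|F| <= (l * t + 2) * B.
    have : l.-1 * (t * B) <= l * (t * B) by rewrite leq_mul2r leq_pred orbT.
    by nia.
  have : q * (2 * #|F|) <= (l * t + 2) * (6 * #|F|).
    apply: leq_trans (_ : q * ((l * t + 2) * B) <= _).
      by rewrite leq_mul2l h1 orbT.
    by rewrite mulnCA leq_mul2l qB orbT.
  by nia.
have iter_good r d' i : d' \in long_darts r -> i <= r -> iter i next_dart d' \in good_darts.
  elim: r d' i => [|r IH] d' [|i] //=; first by rewrite inE => /andP[].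
  by rewrite inE -iterS iterSr => /andP[_ /IH]; apply.
pose e i := (iter i next_dart d).1.
(* Darts record exits only, so the walk starts at the vertex by which the first edge is entered. *)
pose v i := if i is i'.+1 then (iter i' next_dart d).2 else other_end d.1 d.2.
have G i : i < l -> iter i next_dart d \in good_darts.
  by move=> il; apply: iter_good dl _; rewrite -ltnS prednK.
have good i : i < l -> [/\ good_edge (e i), v i \in shared (e i),
    v i.+1 \in shared (e i), v i != v i.+1 & shared (e i) = [set v i; v i.+1]].
  move=> il; have [gd sd dF ed d2] := good_dartP (G _ il).
  case: i il gd sd dF ed d2 => [|i] il gd sd dF ed d2.
    by have [s1 s2 s3] := other_endP gd sd; split=> //; rewrite setUC.
  have [gd' sd' dF' ed' d2'] := good_dartP (G _ (ltnW il)).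
  have [oF yo _ _] := other_edgeP dF' ed' d2'.
  have ysh : v i.+1 \in shared (e i.+1) by rewrite inE [v _ \in _]yo d2' orbT.
  by have [s1 s2 s3] := other_endP gd ysh; split=> //; rewrite eq_sym.
exists v, e; split; last by move=> i /good[].
split=> [i /good[/good_edgeP[]//]|i /good[ge vi vi1 ne _]|i il|i f il fF vf].
- by have [? _ _] := good_edge_shared ge vi; have [? _ _] := good_edge_shared ge vi1.
- have [gd sd dF ed d2] := good_dartP (G _ (ltnW il)).
  by have [_ _ + _] := other_edgeP dF ed d2; rewrite eq_sym.
- have [gd sd dF ed d2] := good_dartP (G _ (ltnW il)).
  by have [_ _ _ only] := other_edgeP dF ed d2; apply: only.
Qed.

End Degrees.

End Hypergraph.

(** * One assignment outside a closed set that satisfies all edges *)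

Section ConstantExtension.
Variables (t s n l : nat) (D : finType) (RT : 'I_s -> {set t.-tuple D}).
Variable lab : {set 'I_n} -> t.-tuple 'I_n * 'I_s.
Implicit Types (F : {set {set 'I_n}}) (Z : {set 'I_n}) (psi : 'I_n -> D).

Definition labelled (e : {set 'I_n}) :=
  uniq (lab e).1 && ([set x | x \in ((lab e).1 : seq 'I_n)] == e).

Definition sat (e : {set 'I_n}) psi := map_tuple psi (lab e).1 \in RT (lab e).2.

Lemma labelled_mem e x : labelled e -> (x \in e) = (x \in ((lab e).1 : seq 'I_n)).
Proof. by case/andP=> _ /eqP eE; rewrite -[in LHS]eE inE. Qed.

Lemma labelled_card e : labelled e -> #|e| = t.
Proof.
move=> /andP[u /eqP eE]; rewrite -{1}eE cardsE.
by rewrite (card_uniqP u) size_tuple.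
Qed.

Lemma eq_sat e psi psi' : labelled e -> {in e, psi =1 psi'} -> sat e psi -> sat e psi'.
Proof.
move=> le ee; rewrite /sat.
suff -> : map_tuple psi (lab e).1 = map_tuple psi' (lab e).1 by [].
by apply: eq_from_tnth => i; rewrite !tnth_map ee // labelled_mem // mem_tnth.
Qed.

Hypotheses (t_gt1 : 1 < t) (l_gt0 : 0 < l).
Hypotheses (RT_lax : lax RT) (RT_null : null_constraining l RT).

(** Laxness gives values by position in the tuple; [pick] turns a vertex back into its position. The
    values are fixed before [psi], hence before the value at [x]. *)
Lemma lax_edge e x : labelled e -> x \in e -> exists b : 'I_n -> D,
  forall psi, (forall y, y \in e -> y != x -> psi y = b y) -> sat e psi.
Proof.
move=> le xe; have /andP[ue _] := le; have := xe.
rewrite labelled_mem // => /tnthP[j xE].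
have [b bE] := RT_lax (lab e).2 j.
exists (fun y => tnth b (odflt j [pick i | tnth (lab e).1 i == y])) => psi psiE.
rewrite /sat; have := bE (psi x).
suff <- : map_tuple psi (lab e).1 = [tuple if i == j then psi x else tnth b i | i < t].
  by [].
apply: eq_from_tnth => i.
rewrite tnth_map tnth_mktuple; case: (eqVneq i j) => [->|ij]; first by rewrite xE.
rewrite psiE; first last.
- by rewrite xE; apply: contra ij => /eqP /(tuple_uniqP _ ue) ->.
- by rewrite labelled_mem // mem_tnth.
case: pickP => [i' /eqP /(tuple_uniqP _ ue) -> //|/(_ i)]; by rewrite eqxx.
Qed.

(** The walk edges alone form a simple path instance of length [l]: inner vertices lie in exactly
    two of them, and vertices that are not shared in one. *)
Lemma path_edges F Z v e : (forall f, f \in F -> labelled f) ->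
  no_short_cycle l F -> is_walk F l v e ->
  (forall i, i < l -> good_edge F Z (e i) /\ shared F Z (e i) = [set v i; v i.+1]) ->
  forall i1 i2 : D, exists h : 'I_n -> D,
    [/\ h (v 0) = i1, h (v l) = i2 & forall i, i < l -> sat (e i) h].
Proof.
move=> Flab nc walk good i1 i2; have [einj vinj] := walk_inj walk nc.
have [eF ve _ only] := walk.
pose RA (G : 'I_s) := [set tu | [exists i : 'I_l, lab (e i) == (tu, G)]].
have RAP G tu : reflect (exists2 i : nat, i < l & lab (e i) = (tu, G)) (tu \in RA G).
  rewrite inE; apply: (iffP existsP) => [[i /eqP]|[i il iE]]; first by exists i.
  by exists (Ordinal il); apply/eqP.
have RA_hedges : hedges RA = [set e (nat_of_ord j) | j : 'I_l].
  apply/setP=> f; apply/bigcupP/imsetP => [[G _ /imsetP[tu /RAP[i il iE] ->]]|[j _ ->]].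
    exists (Ordinal il) => //=; have /andP[_ /eqP] := Flab _ (eF _ il).
    by rewrite iE.
  exists (lab (e j)).2 => //; apply/imsetP; exists (lab (e j)).1.
    by apply/RAP; exists j => //; case: lab.
  by have /andP[_ /eqP ->] := Flab _ (eF _ (ltn_ord j)).
have RA_inst : is_instance RA.
  by move=> G tu /RAP[i il iE]; have /andP[+ _] := Flab _ (eF _ il); rewrite iE.
have [|h [hom [h0 hl]]] := RT_null (p := l) (RA := RA) (v := v) (e := e) (leqnn l) _ i1 i2.
  split=> //; split=> //; split; first by move=> i j il jl; apply: vinj.
  split; first by move=> i j il jl; apply: einj.
  split; first by move=> i il; rewrite RA_hedges; apply/imsetP; exists (Ordinal il).
  split; first by move=> i il; have [? ? _] := ve _ il.
  split=> [i x il xe xi xi1|i i0 il].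
    rewrite -(cards1 (Ordinal il)); congr #|pred_of_set _|; apply/setP=> j.
    rewrite !inE; apply/idP/eqP => [xj|->//].
    have : x \notin shared F Z (e i).
      by rewrite (good _ il).2 !inE negb_or xi.
    rewrite inE xe negb_or -leqNgt => /andP[_ d1].
    apply: val_inj; apply: einj; rewrite ?inE ?ltn_ord //.
    by apply: degree1P d1 _ _ xj xe; apply: eF.
  have i1l : i.-1 < l by lia.
  have iS : i.-1.+1 = i by lia.
  have -> : [set j : 'I_l | v i \in e j] = [set Ordinal i1l; Ordinal il].
    apply/setP=> j; rewrite !inE -!val_eqE /=; apply/idP/orP => [vj|].
      have := only i.-1 (e j); rewrite iS => /(_ il (eF _ (ltn_ord j)) vj).
      by case=> /einj -> //; rewrite ?inE //; [left|right].
    case=> /eqP ->; last by case: (ve _ il).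
    by have [_ + _] := ve _ i1l; rewrite iS.
  by rewrite cards2 -val_eqE /= neq_ltn; have -> : i.-1 < i by lia.
exists h; split=> // i il; apply: hom; apply/RAP; exists i => //; by case: lab.
Qed.

(** The density assumption passes to subfamilies, which permits induction on the number of edges. As
    [psi] is free on [Z], the same [h] serves all homomorphisms there. *)
Lemma constant_extension q F Z (d0 : D) :
  (forall f, f \in F -> labelled f) -> no_short_cycle l F -> 3 * (l * t + 2) < q ->
  (forall F', F' \subset F -> (q * (t - 1) - 1) * #|F'| <= q * #|cover F' :\: Z|) ->
  exists h : 'I_n -> D, forall e psi, e \in F ->
    (forall y, y \in e -> y \notin Z -> psi y = h y) -> sat e psi.
Proof.
move=> + + ql; elim: {F}_.+1 {-2}F (ltnSn #|F|) => // m IH F Fm Flab nc dense.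
have [->|F0] := eqVneq F set0.
  by exists (fun=> d0) => e psi; rewrite inE.
have IHF F' : F' \proper F -> exists h : 'I_n -> D, forall e psi, e \in F' ->
    (forall y, y \in e -> y \notin Z -> psi y = h y) -> sat e psi.
  move=> F'F; have sub := proper_sub F'F; apply: IH.
  - exact: leq_trans (proper_card F'F) _.
  - by move=> f /(subsetP sub)/Flab.
  - exact: no_short_cycleS sub nc.
  - by move=> F'' h; apply/dense/(subset_trans h).
have [/exists_inP[e eF sh1]|] := boolP [exists e in F, #|shared F Z e| <= 1].
  have lab_e := Flab _ eF.
  have [x xe xsh] : exists2 x, x \in e & forall y, y \in shared F Z e -> y = x.
    have [sh0|/set0Pn[x xsh]] := eqVneq (shared F Z e) set0.
      have /card_gt0P[x xe] : 0 < #|e| by rewrite labelled_card // ltnW.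
      by exists x => // y; rewrite sh0 inE.
    exists x; first by move: xsh; rewrite inE => /andP[].
    by move=> y ysh; apply: (card_le1_eqP sh1).
  have [|h' h'E] := IHF (F :\ e); first by rewrite properD1.
  have [b bE] := lax_edge lab_e xe.
  (* Vertices of [e] that are not shared lie outside [Z] and in no other edge of [F], so overwriting
     their values does no harm. *)
  exists (fun y => if y \in e :\: shared F Z e then b y else h' y).
  move=> f psi fF psiE; have [fe|fe] := eqVneq f e.
    rewrite fe in psiE *; apply: bE => y ye yx; have ysh : y \notin shared F Z e.
      by apply: contra yx => /xsh ->.
    have yZ : y \notin Z by move: ysh; rewrite inE ye negb_or => /andP[].
    by rewrite psiE // inE ysh ye.
  apply: h'E => [|y yf yZ]; first by rewrite !inE fe.
  rewrite psiE // inE; case: (boolP (y \in e)) => ye; last by rewrite andbF.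
  by rewrite inE ye (degree_gt1 eF fF ye yf) ?orbT // eq_sym.
rewrite negb_exists_in => /forall_inP Fsh.
have [||v [e [walk good]]] := exists_good_walk l_gt0 _ _ F0 ql (dense _ (subxx F)).
- by move=> f /Flab/labelled_card.
- by move=> f /Fsh; rewrite -ltnNge.
have [eF ve _ only] := walk.
pose P := [set e (nat_of_ord i) | i : 'I_l].
have PP f : reflect (exists2 i, i < l & f = e i) (f \in P).
  apply: (iffP imsetP) => [[i _ ->]|[i il ->]]; first by exists i.
  by exists (Ordinal il).
have [|h' h'E] := IHF (F :\: P).
  rewrite properEneq subsetDl andbT; apply/eqP=> /setP/(_ (e 0)).
  rewrite inE eF //; have -> : e 0 \in P by apply/PP; exists 0.
  by [].
(* The remaining edges meet the path in its two ends at most, and there [hP] is made to agree with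
   [h']. *)
have [hP [hP0 hPl hPE]] := path_edges Flab nc walk good (h' (v 0)) (h' (v l)).
exists (fun y => if y \in cover P then hP y else h' y) => f psi fF psiE.
have [/PP[i il fi]|nP] := boolP (f \in P).
  rewrite fi in fF psiE *; apply: eq_sat (hPE _ il); first exact: Flab.
  move=> y ye; have [ge _] := good _ il.
  have yZ : y \notin Z.
    have [/(good_edge_shared ge)[]//|] := boolP (y \in shared F Z (e i)).
    by rewrite inE ye negb_or => /andP[].
  rewrite psiE // ifT //; apply/bigcupP; exists (e i) => //.
  by apply/PP; exists i.
apply: h'E => [|y yf yZ]; first by rewrite inE nP.
rewrite psiE //; case: ifP => // /bigcupP[_ /PP[i il ->] ye].
have fe : e i != f by apply: contra nP => /eqP <-; apply/PP; exists i.
have : y \in shared F Z (e i) by rewrite inE ye (degree_gt1 _ _ ye yf fe) ?orbT ?eF.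
have inner j : 0 < j -> j < l -> y <> v j.
  case: j => // j _ jl yv; case/negP: nP; apply/PP; rewrite yv in yf.
  by case: (only _ _ jl fF yf) => ->; [exists j; rewrite // ltnW|exists j.+1].
rewrite (good _ il).2 !inE => /orP[] /eqP yv.
  case: i il yv {ye fe} => [|i] il yv; first by rewrite yv.
  by case: (inner i.+1).
have [il1|il1] := ltnP i.+1 l; first by case: (inner i.+1).
have -> : y = v l by rewrite yv; congr v; apply/eqP; rewrite eqn_leq il1 il.
by [].
Qed.

End ConstantExtension.

Definition hyperedges (t s n : nat) (g : outcome t s n) : {set {set 'I_n}} :=
  [set e | g e != None].

Lemma exists_subset_card (T : finType) (A : {set T}) m : m <= #|A| ->
  exists2 B : {set T}, B \subset A & #|B| = m.
Proof.
move=> mA; exists [set x in take m (enum A)].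
  by apply/subsetP=> x; rewrite inE => /mem_take; rewrite mem_enum.
rewrite cardsE (card_uniqP _) ?take_uniq ?enum_uniq //.
by rewrite size_takel // -cardE.
Qed.

Lemma coverU (T : finType) (P Q : {set {set T}}) :
  cover (P :|: Q) = cover P :|: cover Q.
Proof.
apply/setP=> x; rewrite inE; apply/bigcupP/orP => [[A]|[]/bigcupP[A AP xA]].
- by rewrite inE => /orP[AP|AQ] xA; [left|right]; apply/bigcupP; exists A.
- by exists A; rewrite // inE AP.
- by exists A; rewrite // inE AP orbT.
Qed.

Lemma cover_mono (T : finType) (P Q : {set {set T}}) :
  P \subset Q -> cover P \subset cover Q.
Proof. by move=> /setUidPr <-; rewrite coverU subsetUl. Qed.

(** * Closed sets, their closures, and acceptance for one hypergraph *)

Section RelativelySparse.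
Variables (V : finType) (E : {set {set V}}) (a q M : nat).
Implicit Types (F : {set {set V}}) (X Z : {set V}).

Definition rel_sparse Z := forall F, F \subset E ->
  (forall e, e \in F -> ~~ (e \subset Z)) -> #|F| <= M -> a * #|F| <= q * #|cover F :\: Z|.

(** Edges of [F] inside [Z1] are not inside [Z2], so [Z2] controls them and [Z1] controls the rest.
    No vertex is counted twice, because the first kind of edges covers only vertices of [Z1]. *)
Lemma rel_sparseI Z1 Z2 : rel_sparse Z1 -> rel_sparse Z2 -> rel_sparse (Z1 :&: Z2).
Proof.
move=> c1 c2 F FE Fout FM.
pose F1 := [set e in F | e \subset Z1]; pose F2 := [set e in F | ~~ (e \subset Z1)].
have F1F : F1 \subset F by apply/subsetP=> e; rewrite inE => /andP[].
have F2F : F2 \subset F by apply/subsetP=> e; rewrite inE => /andP[].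
have FF : #|F| = #|F1| + #|F2|.
  rewrite -(cardsID [set e : {set V} | e \subset Z1] F).
  by congr addn; apply: eq_card => e; rewrite !inE // andbC.
have h1 : a * #|F1| <= q * #|cover F1 :\: Z2|.
  apply: c2; first exact: subset_trans FE.
    move=> e; rewrite inE => /andP[eF e1]; have := Fout e eF.
    by rewrite subsetI e1.
  exact: leq_trans (subset_leq_card F1F) FM.
have h2 : a * #|F2| <= q * #|cover F2 :\: Z1|.
  apply: c1; first exact: subset_trans FE.
    by move=> e; rewrite inE => /andP[].
  exact: leq_trans (subset_leq_card F2F) FM.
have c1Z : cover F1 \subset Z1.
  by apply/bigcupsP => e; rewrite inE => /andP[].
have : #|cover F1 :\: Z2| + #|cover F2 :\: Z1| <= #|cover F :\: (Z1 :&: Z2)|.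
  rewrite -cardsUI [X in _ + X](_ : _ = 0) ?addn0; last first.
    apply/eqP; rewrite cards_eq0; apply/eqP/setP=> x; rewrite !inE.
    have [|] := boolP (x \in cover F1); last by rewrite andbF.
    by move=> /(subsetP c1Z) ->; rewrite /= andbF.
  apply/subset_leq_card; rewrite subUset; apply/andP; split.
    by apply: setDSS; [exact: cover_mono|exact: subsetIr].
  by apply: setDSS; [exact: cover_mono|exact: subsetIl].
by rewrite -(leq_pmul2l (m := q.+1)) // FF; nia.
Qed.

End RelativelySparse.

Section Acceptance.
Variables (t s n l m q k : nat) (D : finType) (RT : 'I_s -> {set t.-tuple D}).
Variable g : outcome t s n.
Implicit Types (X Y Z : {set 'I_n}).
Hypotheses (t_gt1 : 1 < t) (l_gt0 : 0 < l) (m_gt0 : 0 < m) (k_gt0 : 0 < k).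
Hypotheses (s_gt0 : 0 < s) (RT_lax : lax RT) (RT_null : null_constraining l RT).
Hypothesis q_large : 3 * (l * t + 2) < q.
Hypothesis g_valid : valid_outcome m g.
Hypothesis g_girth : no_short_cycle l (hyperedges g).

(** A closure consists of [k] vertices and at most [2 q k] edges that add at most [t - 1] vertices
    each on average. A set of size [K] contains at most [M] edges, and sparsity up to [2 M] allows
    joining one more family of size [M]. *)
Let K := (1 + (t - 1) * (2 * q)) * k.
Let M := 2 * K.

Hypothesis g_sparse : forall F : {set {set 'I_n}}, F \subset hyperedges g -> #|F| <= 2 * M ->
  (2 * q * (t - 1) - 1) * #|F| <= 2 * q * #|cover F|.

Local Notation E := (hyperedges g).
Local Notation sparse_rel := (rel_sparse E (q * (t - 1) - 1) q M).
Let small_closed (Z : {set 'I_n}) := (#|Z| <= K) && pdec (sparse_rel Z).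

Lemma small_closed0 : small_closed set0.
Proof.
rewrite /small_closed cards0 /=; apply/pdecP=> F FE _ FM; rewrite setD0.
by have := g_sparse FE (leq_trans FM _); rewrite leq_pmull // => /(_ isT); nia.
Qed.

Lemma small_closedI X Y : small_closed X -> small_closed Y -> small_closed (X :&: Y).
Proof.
move=> /andP[XK /pdecP cX] /andP[YK /pdecP cY]; apply/andP; split.
  exact: leq_trans (subset_leq_card (subsetIl _ _)) XK.
exact/pdecP/rel_sparseI.
Qed.

(** Let [F] be a largest family covering at most [(t - 1 - 1/q) |F|] vertices outside [X]. Sparsity
    gives [(t - 1 - 1/(2q)) |F| <= k + (t - 1 - 1/q) |F|], so [|F| <= 2 q k]. A family violating
    closedness of [X :|: cover F] could be joined to [F]. *)
Lemma small_closed_cover X : #|X| <= k -> exists2 Y, small_closed Y & X \subset Y.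
Proof.
move=> Xk.
pose P (F : {set {set 'I_n}}) := [&& F \subset E, #|F| <= 2 * M &
  q * #|cover F :\: X| <= (q * (t - 1) - 1) * #|F|].
have P0 : P set0 by rewrite /P sub0set cards0 /cover big_set0 set0D cards0 muln0.
have Pk F : P F -> #|F| <= 2 * q * k.
  move=> /and3P[FE FM FX]; have := g_sparse FE FM.
  have : #|cover F| <= #|X| + #|cover F :\: X|.
    by rewrite -(cardsID X) leq_add2r subset_leq_card // subsetIr.
  have : 0 < q * (t - 1) by rewrite muln_gt0; lia.
  by nia.
case: (arg_maxnP (fun F : {set {set 'I_n}} => #|F|) P0) => F PF Fmax.
have Fk := Pk F PF; have /and3P[FE FM FX] := PF.
exists (X :|: cover F); last exact: subsetUl.
apply/andP; split.
  have -> : X :|: cover F = X :|: (cover F :\: X).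
    by apply/setP=> x; rewrite !inE; case: (x \in X).
  apply: leq_trans (leq_card_setU _ _) _.
  have : q * #|cover F :\: X| <= q * ((t - 1) * #|F|) by nia.
  by rewrite leq_pmul2l ?(leq_trans _ q_large) // /K; nia.
apply/pdecP=> F' F'E F'out F'M; rewrite leqNgt; apply/negP=> bad.
have F'0 : 0 < #|F'| by case: #|F'| bad => //; rewrite muln0.
have dis : [disjoint F & F'].
  rewrite disjoint_subset; apply/subsetP=> e eF; rewrite inE.
  apply/negP=> /F'out /negP; apply; apply: subset_trans (subsetUr _ _).
  exact: bigcup_sup.
have cU : #|F :|: F'| = #|F| + #|F'|.
  by rewrite cardsU (disjoint_setI0 dis) cards0 subn0.
have : P (F :|: F').
  rewrite /P subUset FE F'E cU /=; apply/andP; split.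
    have qK : 2 * q * k <= K.
      rewrite /K leq_mul2r (leq_trans _ (leqnSn _)) ?orbT //.
      by rewrite leq_pmull // subn_gt0.
    apply: leq_trans (leq_add (leq_trans Fk qK) F'M) _.
    by rewrite /M; move: (K) => K'; lia.
  have : #|cover (F :|: F') :\: X| <=
      #|cover F :\: X| + #|cover F' :\: (X :|: cover F)|.
    apply: leq_trans (leq_card_setU _ _); apply/subset_leq_card/subsetP=> x.
    by rewrite coverU !inE; case: (x \in X); case: (x \in cover F).
  move=> h; apply: leq_trans (leq_mul (leqnn q) h) _.
  by rewrite !mulnDr leq_add // ltnW.
by move=> /Fmax; rewrite /= cU -{2}[#|F|]addn0 leq_add2l leqNgt F'0.
Qed.

Lemma small_closed_ext X Z : small_closed X -> small_closed Z -> Z \subset X ->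
  exists h : 'I_n -> D, forall phi, phi \in homX (inst_of g) RT Z ->
    glue X Z h phi \in homX (inst_of g) RT X.
Proof.
move=> /andP[XK _] /andP[_ /pdecP cZ] ZX.
have /andP[/eqP cE /forallP vE] := g_valid.
have /set0Pn[e0] : E != set0 by rewrite -card_gt0 cE.
rewrite inE; case ge0: (g e0) => [lab0|//] _.
pose lab e := odflt lab0 (g e).
have labE e G tu : g e = Some (tu, G) -> lab e = (tu, G) by rewrite /lab => ->.
have lab_ok e : e \in E -> labelled lab e.
  rewrite inE /labelled /lab; have := vE e.
  by case: (g e) => [[tu G]|].
pose F := [set e in E | (e \subset X) && ~~ (e \subset Z)].
have FE : F \subset E by apply/subsetP=> e; rewrite inE => /andP[].
have K0 : 0 < K by rewrite /K muln_gt0 k_gt0.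
(* Otherwise some [M.+1] edges inside [X] would, by sparsity, cover at least [M.+1 / 2] vertices,
   more than [K]. *)
have FM : #|F| <= M.
  rewrite leqNgt; apply/negP=> /exists_subset_card[F' F'F cF'].
  have := g_sparse (subset_trans F'F FE); rewrite cF' => /(_ _).
  have F'X : #|cover F'| <= #|X|.
    apply/subset_leq_card/bigcupsP=> e /(subsetP F'F).
    by rewrite !inE => /and3P[].
  have qt : q <= q * (t - 1) by rewrite leq_pmulr //; lia.
  have h : M.+1 <= 2 * M by rewrite /M; move: (K) K0 => K'; lia.
  move=> /(_ h) le1; have q0 : 0 < q by exact: leq_trans q_large.
  have : q * M.+1 <= q * M.
    apply: (@leq_trans ((2 * q * (t - 1) - 1) * M.+1)).
      by rewrite leq_mul2r -mulnA; apply/orP; right; lia.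
    apply: leq_trans le1 _; rewrite /M mulnA [q * 2]mulnC leq_mul2l.
    by rewrite (leq_trans F'X XK) orbT.
  by rewrite leq_pmul2l // ltnn.
have d0 : D.
  have t0 : 0 < t by exact: ltnW.
  exact: (tnth (proj1_sig (constructive_indefinite_description _
    (RT_lax (Ordinal s_gt0) (Ordinal t0)))) (Ordinal t0)).
have F_lab f : f \in F -> labelled lab f by move=> /(subsetP FE); apply: lab_ok.
have F_sparse (F' : {set {set 'I_n}}) : F' \subset F ->
    (q * (t - 1) - 1) * #|F'| <= q * #|cover F' :\: Z|.
  move=> F'F; apply: cZ; first exact: subset_trans FE.
    by move=> e /(subsetP F'F); rewrite !inE => /and3P[].
  exact: leq_trans (subset_leq_card F'F) FM.
have [h hE] := @constant_extension _ _ _ _ _ _ lab t_gt1 l_gt0 RT_lax RT_null q F Z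
  d0 F_lab (no_short_cycleS FE g_girth) q_large F_sparse.
exists h => phi hphi; have dom := hom_dom hphi.
pose psi x := if x \in Z then odflt d0 (phi x) else h x.
have glueE x : x \in X -> glue X Z h phi x = Some (psi x).
  move=> xX; rewrite ffunE /psi xX; case: ifP => // xZ.
  by have := dom x; rewrite xZ; case: (phi x).
rewrite inE; apply/andP; split.
  apply/eqP/setP=> x; rewrite inE; case: (boolP (x \in X)) => xX; first by rewrite glueE.
  by rewrite ffunE (negPf xX) ifF //; apply: contraNF xX => /(subsetP ZX).
apply/forallP=> G; apply/forall_inP=> tu tuG; apply/implyP=> /allP tuX.
have [e /eqP ge] : exists e, g e == Some (tu, G) by move: tuG; rewrite inE => /existsP.
have eE : e \in E by rewrite inE ge.
have lab_e := lab_ok _ eE.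
have eX : e \subset X.
  by apply/subsetP=> x; rewrite (labelled_mem _ lab_e) (labE _ _ _ ge) => /tuX.
apply/exists_inP; have [eZ|eZ] := boolP (e \subset Z).
  move: hphi; rewrite inE => /andP[_ /forallP/(_ G)/forall_inP/(_ tu tuG)/implyP].
  have tuZ x : x \in tu -> x \in Z.
    by move=> xt; apply: (subsetP eZ); rewrite (labelled_mem _ lab_e) (labE _ _ _ ge).
  have -> : all (fun x => x \in Z) tu by apply/allP.
  move=> /(_ isT) /exists_inP[u uG /eqP uE]; exists u => //; apply/eqP; rewrite uE.
  by apply/eq_in_map=> x /tuZ xZ; rewrite ffunE xZ.
exists (map_tuple psi tu).
  have : sat RT lab e psi.
    apply: hE => [|y _ yZ]; first by rewrite inE eE eX.
    by rewrite /psi (negPf yZ).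
  by rewrite /sat (labE _ _ _ ge).
by apply/eqP; rewrite /= -map_comp; apply/eq_in_map => x /tuX xX; rewrite glueE.
Qed.

Lemma cohom_accepts_sparse : cohom_accepts (inst_of g) RT k.
Proof.
apply: (@cohom_accepts_local _ _ _ _ _ _ _ small_closed).
- exact: ltnW.
- exact: small_closed0.
- exact: small_closedI.
- exact: small_closed_cover.
- exact: small_closed_ext.
Qed.

End Acceptance.

(** * Binomial random subsets *)

Local Open Scope ring_scope.

Section BinomialModel.
Variables (R : realFieldType) (I : finType) (U : {set I}) (p : R).
Hypothesis p01 : 0 <= p <= 1.
Implicit Types (S C : {set I}) (f g : {set I} -> R).

Definition binom_wt S : R := p ^+ #|S| * (1 - p) ^+ (#|U| - #|S|).
Definition binom_E f : R := \sum_(S : {set I} | S \subset U) binom_wt S * f S.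

Lemma binom_wt_ge0 S : 0 <= binom_wt S.
Proof. by case/andP: p01 => p0 p1; rewrite mulr_ge0 ?exprn_ge0 ?subr_ge0. Qed.

Lemma eq_binom_E f g : (forall S, S \subset U -> f S = g S) -> binom_E f = binom_E g.
Proof. by move=> fg; apply: eq_bigr => S /fg ->. Qed.

Lemma le_binom_E f g : (forall S, S \subset U -> f S <= g S) -> binom_E f <= binom_E g.
Proof. by move=> fg; apply: ler_sum => S /fg; apply/ler_wpM2l/binom_wt_ge0. Qed.

Lemma binom_ED f g : binom_E (fun S => f S + g S) = binom_E f + binom_E g.
Proof. by rewrite -big_split; apply: eq_bigr => S _; rewrite mulrDr. Qed.

Lemma binom_EZ a f : binom_E (fun S => a * f S) = a * binom_E f.
Proof. by rewrite [RHS]big_distrr; apply: eq_bigr => S _; rewrite /= mulrCA. Qed.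

Lemma binom_E_sum (J : finType) (P : pred J) (F : J -> {set I} -> R) :
  binom_E (fun S => \sum_(j | P j) F j S) = \sum_(j | P j) binom_E (F j).
Proof.
by rewrite exchange_big; apply: eq_bigr => S _; rewrite /= big_distrr.
Qed.

(** Expanding the product decides for each element whether it is present, with weight [p * w i], or
    absent, with weight [1 - p]. The factor 0 for elements outside [U] removes the sets not
    contained in [U]. *)
Lemma binom_E_prod (w : I -> R) :
  binom_E (fun S => \prod_(i in S) w i) = \prod_(i in U) (1 - p + p * w i).
Proof.
pose F i := if i \in U then p * w i else 0.
pose G i := if i \in U then 1 - p else 1.
transitivity (\prod_i (F i + G i)); last first.
  rewrite [RHS]big_mkcond; apply: eq_bigr => i _; rewrite /F /G.
  by case: ifP => _; rewrite ?add0r // addrC.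
rewrite bigA_distr /binom_E big_mkcond; apply: eq_bigr => S _.
case: ifPn => [SU|/subsetPn[i iS iU]]; last first.
  by rewrite (bigD1 i) //= iS /F (negPf iU) mul0r.
rewrite [RHS](bigID (mem S)) /= /binom_wt mulrAC; congr (_ * _).
  rewrite -prodr_const -big_split; apply: eq_big => i // iS.
  by rewrite iS /F (subsetP SU).
rewrite -(cardsDS SU) -prodr_const big_mkcond [RHS]big_mkcond; apply: eq_bigr => i _.
by rewrite inE; case: (i \in S) => //=; rewrite /G; case: (i \in U).
Qed.

Lemma binom_E1 : binom_E (fun=> 1) = 1.
Proof.
transitivity (binom_E (fun S => \prod_(i in S) 1)).
  by apply: eq_binom_E => S _; rewrite big1.
by rewrite binom_E_prod big1 // => i _; rewrite mulr1 subrK.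
Qed.

Lemma binom_E_mem x f : x \in U ->
  binom_E (fun S => (x \in S)%:R * f S) = p * binom_E (fun S => f (x |: S)).
Proof.
move=> xU; rewrite /binom_E (bigID (fun S : {set I} => x \in S)) /= [X in _ + X]big1 ?addr0; last first.
  by move=> S /andP[_ /negPf ->]; rewrite mul0r mulr0.
rewrite [in RHS](bigID (fun S : {set I} => x \in S)) /= mulrDr.
set A := \sum_(S : {set I} | _ && (x \in S)) _.
have -> : p * \sum_(S : {set I} | (S \subset U) && (x \in S)) binom_wt S * f (x |: S) = p * A.
  congr (_ * _); apply: eq_bigr => S /andP[_ xS]; rewrite xS mul1r; congr (_ * f _).
  by apply/setUidPr; rewrite sub1set.
suff -> : p * \sum_(S : {set I} | (S \subset U) && (x \notin S)) binom_wt S * f (x |: S) = (1 - p) * A.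
  by ring.
rewrite !big_distrr /= [RHS](reindex_onto (fun S : {set I} => x |: S) (fun S => S :\ x)) /=; last first.
  by move=> S /andP[_ xS]; rewrite setD1K.
apply: eq_big => S.
  rewrite subUset sub1set xU setU11 andbT /=; congr (_ && _).
  apply/idP/eqP => [xS|<-]; last by rewrite !inE eqxx.
  apply/setP=> y; rewrite !inE; case: eqP => [->|] //=.
  by rewrite (negPf xS).
move=> /andP[SU xS]; rewrite setU11 mul1r /binom_wt cardsU1 xS add1n exprS.
have lt : (#|S| < #|U|)%N.
  apply: proper_card; rewrite properE SU; apply/subsetPn; by exists x.
by rewrite -[(#|U| - #|S|)%N]prednK ?subn_gt0 // exprS -subnS; ring.
Qed.

(** Given that [C] is present, the other elements keep their distribution, so [S] may be replaced by
    [C :|: S]. *)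
Lemma binom_E_subset C f : C \subset U ->
  binom_E (fun S => (C \subset S)%:R * f S) = p ^+ #|C| * binom_E (fun S => f (C :|: S)).
Proof.
elim: {C}_.+1 {-2}C (ltnSn #|C|) f => // m IH C Cm f CU.
have [->|/set0Pn[x xC]] := eqVneq C set0.
  rewrite cards0 mul1r; apply: eq_binom_E => S _.
  by rewrite sub0set mul1r set0U.
have C'm : (#|C :\ x| < m)%N by rewrite (cardsD1 x) xC in Cm.
have C'U : C :\ x \subset U by apply: subset_trans CU; apply: subD1set.
transitivity (binom_E (fun S => (x \in S)%:R * ((C :\ x \subset S)%:R * f S))).
  apply: eq_binom_E => S _; rewrite mulrA -natrM mulnb -{1}(setD1K xC).
  by rewrite subUset sub1set.
rewrite binom_E_mem ?(subsetP CU) //.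
transitivity (p * binom_E (fun S => (C :\ x \subset S)%:R * f (x |: S))).
  congr (_ * _); apply: eq_binom_E => S _; congr (_%:R * _).
  by rewrite -subDset setDDl setUid.
rewrite IH // mulrA -exprS [#|C|](cardsD1 x) xC; congr (_ * _).
by apply: eq_binom_E => S _; rewrite setUA setD1K.
Qed.

Definition antitone f := forall S S', S \subset S' -> f S' <= f S.

(* Conditioning on [C \subset S] replaces [f S] by [f (C :|: S) <= f S]. *)
Lemma binom_E_avoid (Cs : seq {set I}) f : (forall C, C \in Cs -> C \subset U) ->
  (forall S, 0 <= f S) -> antitone f ->
  (\prod_(C <- Cs) (1 - p ^+ #|C|)) * binom_E f <=
    binom_E (fun S => (all (fun C => ~~ (C \subset S)) Cs)%:R * f S).
Proof.
case/andP: p01 => p0 p1.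
elim: Cs f => [|C Cs IH] f CsU f0 fdec.
  by rewrite big_nil mul1r le_eqVlt (eq_binom_E (g := f)) ?eqxx // => S _; rewrite mul1r.
rewrite big_cons mulrAC; pose f' S := (~~ (C \subset S))%:R * f S.
have f'0 S : 0 <= f' S by rewrite mulr_ge0.
have f'dec : antitone f'.
  move=> S S' SS'; rewrite /f'; case: (boolP (C \subset S)) => CS /=.
    by rewrite (subset_trans CS SS') !mul0r.
  by case: (C \subset S'); rewrite !(mul0r, mul1r) ?f0 ?fdec.
have CU : C \subset U by apply: CsU; rewrite inE eqxx.
have step : (1 - p ^+ #|C|) * binom_E f <= binom_E f'.
  have -> : binom_E f' = binom_E f - p ^+ #|C| * binom_E (fun S => f (C :|: S)).
    apply/esym/eqP; rewrite -binom_E_subset // subr_eq -binom_ED; apply/eqP.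
    by apply: eq_binom_E => S _; rewrite /f' -mulrDl; case: (C \subset S); rewrite ?add0r ?addr0 mul1r.
  rewrite mulrBl mul1r lerB // ler_wpM2l ?exprn_ge0 //.
  by apply: le_binom_E => S _; apply/fdec/subsetUr.
have CsU' C' : C' \in Cs -> C' \subset U by move=> h; apply: CsU; rewrite inE h orbT.
have -> : binom_E (fun S => (all (fun C => ~~ (C \subset S)) (C :: Cs))%:R * f S) =
    binom_E (fun S => (all (fun C => ~~ (C \subset S)) Cs)%:R * f' S).
  by apply: eq_binom_E => S _; rewrite /= /f' mulrA -natrM mulnb andbC.
apply: le_trans (IH _ CsU' f'0 f'dec); rewrite mulrC ler_wpM2l //.
by rewrite big_seq; apply: prodr_ge0 => C' _; rewrite subr_ge0 exprn_ile1.
Qed.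

(** Exponential Markov inequality: the indicator is at most [2 ^ m / 2 ^ |S|], whose expectation
    factorizes. *)
Lemma binom_E_lt m :
  binom_E (fun S => (#|S| < m)%:R) <= 2 ^+ m * (1 - p / 2) ^+ #|U|.
Proof.
have -> : 1 - p / 2 = 1 - p + p * 2^-1 by field.
rewrite -prodr_const -(binom_E_prod (fun=> 2^-1)) -binom_EZ.
apply: le_binom_E => S _; rewrite prodr_const.
have [lt|] := ltnP; last by rewrite mulr_ge0 ?exprn_ge0 ?invr_ge0.
have two1 : 1 <= 2 :> R by rewrite ler1n.
have le2 : 2 ^+ #|S| <= 2 ^+ m :> R by apply: ler_weXn2l => //; apply: ltnW.
have gt2 : 0 < 2 ^+ #|S| :> R by rewrite exprn_gt0 // ltr0n.
by rewrite exprVn (ler_pdivlMr _ _ gt2) mul1r.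
Qed.

Lemma binom_E_card : binom_E (fun S => #|S|%:R) = p * #|U|%:R.
Proof.
transitivity (binom_E (fun S => \sum_(x in U) (x \in S)%:R)).
  apply: eq_binom_E => S SU.
  rewrite -natr_sum -sum1_card; congr _%:R.
  rewrite [RHS]big_mkcond [LHS]big_mkcond /=; apply: eq_bigr => x _.
  by case: (boolP (x \in S)) => [/(subsetP SU) ->|]; case: (x \in U).
rewrite binom_E_sum (eq_bigr (fun=> p)) ?sumr_const ?mulr_natr // => x xU.
transitivity (binom_E (fun S => (x \in S)%:R * 1)).
  by apply: eq_binom_E => S _; rewrite mulr1.
by rewrite binom_E_mem // binom_E1 mulr1.
Qed.

Lemma binom_E_markov m : 0 < m%:R :> R ->
  binom_E (fun S => (m < #|S|)%:R) <= p * #|U|%:R / m%:R.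
Proof.
move=> m0; rewrite ler_pdivlMr // -binom_E_card mulrC -binom_EZ.
apply: le_binom_E => S _; case: ltnP => [lt|]; last by rewrite mulr0.
by rewrite mulr1 ler_nat ltnW.
Qed.

(** * Comparison with uniform subsets of fixed size *)

Definition level m f : R := \sum_(S : {set I} | (S \subset U) && (#|S| == m)) f S.
Definition level_avg m f : R := level m f / 'C(#|U|, m)%:R.

Lemma level1 m : level m (fun=> 1) = 'C(#|U|, m)%:R.
Proof.
rewrite /level -cards_draws -sumr_const.
by apply: eq_bigl => S; rewrite inE.
Qed.

Lemma level_ge0 m f : (forall S, 0 <= f S) -> 0 <= level m f.
Proof. by move=> f0; apply: sumr_ge0. Qed.

(** Both sides sum over pairs of an [m]-set and an element outside it; adding the element can only
    decrease [f]. *)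
Lemma level_step m f : antitone f ->
  m.+1%:R * level m.+1 f <= (#|U| - m)%:R * level m f.
Proof.
move=> fdec; rewrite /level !big_distrr /=.
have -> : \sum_(S : {set I} | (S \subset U) && (#|S| == m.+1)) m.+1%:R * f S =
    \sum_(S : {set I} | (S \subset U) && (#|S| == m.+1)) \sum_(x in S) f S.
  by apply: eq_bigr => S /andP[_ /eqP <-]; rewrite sumr_const mulr_natl.
have -> : \sum_(S : {set I} | (S \subset U) && (#|S| == m)) (#|U| - m)%:R * f S =
    \sum_(S : {set I} | (S \subset U) && (#|S| == m)) \sum_(x in U :\: S) f S.
  by apply: eq_bigr => S /andP[SU /eqP <-]; rewrite sumr_const mulr_natl cardsDS.
rewrite (exchange_big_dep (mem U)) /=; last first.
  by move=> S x /andP[SU _] /(subsetP SU).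
rewrite [leRHS](exchange_big_dep (mem U)) /=; last first.
  by move=> S x _; rewrite inE => /andP[].
apply: ler_sum => x xU.
rewrite (reindex_onto (fun S : {set I} => x |: S) (fun S => S :\ x)) /=; last first.
  by move=> S /andP[_ xS]; rewrite setD1K.
rewrite (eq_bigl (fun S : {set I} => ((S \subset U) && (#|S| == m)) && (x \in U :\: S))).
  by apply: ler_sum => S _; apply/fdec/subsetUr.
move=> S; rewrite subUset sub1set xU setU11 andbT !inE xU andbT /= cardsU1.
have [xS|xS] := boolP (x \in S).
  rewrite [RHS]andbF; apply/negbTE; rewrite negb_and; apply/orP; right.
  by apply/eqP=> /setP/(_ x); rewrite !inE eqxx xS.
rewrite add1n eqSS /= andbT; have -> : ((x |: S) :\ x == S) = true; last by rewrite andbT.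
apply/eqP/setP=> y; rewrite !inE; case: eqP => [->|] //=.
by rewrite (negPf xS).
Qed.

Lemma level_avg_step m f : antitone f -> (m < #|U|)%N ->
  level_avg m.+1 f <= level_avg m f.
Proof.
move=> fdec mU; rewrite /level_avg.
have b1 : 0 < 'C(#|U|, m.+1)%:R :> R by rewrite ltr0n bin_gt0.
have b0 : 0 < 'C(#|U|, m)%:R :> R by rewrite ltr0n bin_gt0 ltnW.
rewrite ler_pdivrMr // mulrAC ler_pdivlMr //.
have h := level_step m fdec.
have e : m.+1%:R * 'C(#|U|, m.+1)%:R = (#|U| - m)%:R * 'C(#|U|, m)%:R :> R.
  by rewrite -!natrM mul_bin_left.
have m0 : 0 < m.+1%:R :> R by rewrite ltr0n.
rewrite -(ler_pM2l m0) [leRHS]mulrCA e [leRHS](_ : _ =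
  ((#|U| - m)%:R * level m f) * 'C(#|U|, m)%:R); last by ring.
by rewrite [leLHS]mulrA ler_wpM2r // ltW.
Qed.

Lemma level_avg_decr m m' f : antitone f -> (m <= m')%N -> (m' <= #|U|)%N ->
  level_avg m' f <= level_avg m f.
Proof.
move=> fdec; elim: m' => [|m' IH]; first by rewrite leqn0 => /eqP ->.
rewrite leq_eqVlt => /orP[/eqP -> //|]; rewrite ltnS => mm' m'U.
by apply: le_trans (IH mm' (ltnW m'U)); apply: level_avg_step.
Qed.

Lemma binom_E_level (phi : nat -> R) f :
  binom_E (fun S => phi #|S| * f S) = \sum_(j < #|U|.+1)
    'C(#|U|, j)%:R * p ^+ j * (1 - p) ^+ (#|U| - j) * phi j * level_avg j f.
Proof.
rewrite /binom_E (partition_big (fun S : {set I} => inord #|S| : 'I_#|U|.+1) xpredT) //=.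
apply: eq_bigr => j _.
have b0 : 'C(#|U|, j)%:R != 0 :> R by rewrite pnatr_eq0 -lt0n bin_gt0 -ltnS.
have -> : 'C(#|U|, j)%:R * p ^+ j * (1 - p) ^+ (#|U| - j) * phi j * level_avg j f =
    p ^+ j * (1 - p) ^+ (#|U| - j) * phi j * level j f by rewrite /level_avg; field.
rewrite /level big_distrr /=; apply: eq_big => S.
  case: (boolP (S \subset U)) => //= SU; rewrite -val_eqE /= inordK //.
  by rewrite ltnS subset_leq_card.
move=> /andP[SU /eqP <-]; rewrite inordK ?ltnS ?subset_leq_card // /binom_wt.
by rewrite !mulrA.
Qed.

Lemma binom_level_wt_ge0 j (phi : nat -> R) : 0 <= phi j ->
  0 <= 'C(#|U|, j)%:R * p ^+ j * (1 - p) ^+ (#|U| - j) * phi j.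
Proof.
by case/andP: p01 => p0 p1 ph; rewrite !mulr_ge0 ?exprn_ge0 ?subr_ge0.
Qed.

Lemma level_avg1 j : (j <= #|U|)%N -> level_avg j (fun=> 1) = 1.
Proof. by move=> jU; rewrite /level_avg level1 divff // pnatr_eq0 -lt0n bin_gt0. Qed.

(** Levels above [m] have averages at most the one at [m], and sets with fewer than [m] elements
    contribute at most their probability. *)
Lemma level_avg_ge m f : (forall S, 0 <= f S <= 1) -> antitone f -> (m <= #|U|)%N ->
  binom_E f - 2 ^+ m * (1 - p / 2) ^+ #|U| <= level_avg m f.
Proof.
move=> f01 fdec mU; rewrite lerBlDr.
apply: le_trans (_ : binom_E (fun S => (m <= #|S|)%:R * f S) +
  binom_E (fun S => (#|S| < m)%:R) <= _).
  rewrite -binom_ED; apply: le_binom_E => S _; have /andP[f0 f1] := f01 S.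
  by rewrite ltnNge; case: leqP => _ /=; rewrite ?mul1r ?mul0r ?addr0 ?add0r.
apply: lerD; last exact: binom_E_lt.
have avg0 : 0 <= level_avg m f.
  by rewrite divr_ge0 // level_ge0 // => S; case/andP: (f01 S).
rewrite (binom_E_level (fun j => (m <= j)%:R)).
apply: le_trans (_ : level_avg m f * binom_E (fun S => (m <= #|S|)%:R * 1) <= _).
  rewrite (binom_E_level (fun j => (m <= j)%:R)) big_distrr /=.
  apply: ler_sum => j _; have jU : (j <= #|U|)%N by rewrite -ltnS ltn_ord.
  rewrite (level_avg1 jU) mulr1 [leLHS]mulrC.
  case: (leqP m j) => mj; last by rewrite !(mulr0, mul0r).
  apply: ler_wpM2r; last by rewrite level_avg_decr.
  by apply: (binom_level_wt_ge0 (phi := fun=> 1)); rewrite ler01.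
rewrite -[leRHS]mulr1 ler_wpM2l // -[leRHS]binom_E1.
by apply: le_binom_E => S _; rewrite mulr1 lern1 leq_b1.
Qed.

(** Here the levels up to [m] are kept, whose averages are at least the one at [m]. *)
Lemma level_avg_le m f : (forall S, 0 <= f S) -> antitone f -> (m <= #|U|)%N ->
  level_avg m f * (1 - binom_E (fun S => (m < #|S|)%:R)) <= binom_E f.
Proof.
move=> f0 fdec mU.
have -> : 1 - binom_E (fun S => (m < #|S|)%:R) = binom_E (fun S => (#|S| <= m)%:R * 1).
  rewrite -[X in X - _]binom_E1; apply/eqP; rewrite subr_eq -binom_ED; apply/eqP.
  by apply: eq_binom_E => S _; rewrite leqNgt; case: ltnP => _ /=; rewrite ?mul0r ?add0r ?mulr1 ?addr0.
apply: le_trans (_ : binom_E (fun S => (#|S| <= m)%:R * f S) <= _); last first.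
  by apply: le_binom_E => S _; case: leqP; rewrite ?mul1r ?mul0r.
rewrite !(binom_E_level (fun j => (j <= m)%:R)) big_distrr /=.
apply: ler_sum => j _; have jU : (j <= #|U|)%N by rewrite -ltnS ltn_ord.
rewrite (level_avg1 jU) mulr1 [leLHS]mulrC.
case: (leqP j m) => mj; last by rewrite !(mulr0, mul0r).
apply: ler_wpM2l; last by rewrite level_avg_decr.
by apply: (binom_level_wt_ge0 (phi := fun=> 1)); rewrite ler01.
Qed.

End BinomialModel.

Local Arguments exp x%_ring_scope.

(** * Random hypergraphs *)

Lemma exp_ge1D (x : R) : 1 + x <= exp x.
Proof. by apply/RleP; exact: exp_ineq1_le. Qed.
Arguments exp_ge1D x%_ring_scope.

Lemma exp_gt0 (x : R) : 0 < exp x.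
Proof. by apply/RltP; exact: exp_pos. Qed.

Lemma exp_N (x : R) : exp (- x) = (exp x)^-1.
Proof. by rewrite -RinvE; exact: exp_Ropp. Qed.

Lemma le_exp (x y : R) : x <= y -> exp x <= exp y.
Proof.
rewrite le_eqVlt => /orP[/eqP -> //|/RltP xy].
by apply/ltW/RltP; exact: exp_increasing.
Qed.

Lemma exp_le1B (x : R) : 0 <= x -> x <= 2^-1 -> exp (- (2 * x)) <= 1 - x.
Proof.
move=> x0 x2; rewrite exp_N; have h := exp_ge1D (2 * x).
have e0 := exp_gt0 (2 * x).
rewrite -[leLHS]div1r (ler_pdivrMr _ _ e0).
(* The product is [1 + x (1 - 2 x)], at least 1 for [x] up to one half. *)
apply: le_trans (_ : (1 - x) * (1 + 2 * x) <= _); first by nra.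
by apply: ler_wpM2l => //; lra.
Qed.

Lemma exp_le_prod (T : eqType) (s : seq T) (x : T -> R) :
  (forall i, i \in s -> 0 <= x i <= 2^-1) ->
  exp (- (2 * \sum_(i <- s) x i)) <= \prod_(i <- s) (1 - x i).
Proof.
elim: s => [|a s IH] h; first by rewrite !big_nil mulr0 oppr0 expR0.
rewrite !big_cons mulrDr opprD -expRD.
have /andP[a0 a2] := h a (mem_head _ _).
apply: ler_pM; rewrite ?(ltW (exp_gt0 _)) ?exp_le1B //.
by apply: IH => i si; apply: h; rewrite inE si orbT.
Qed.

Section UniformEdges.
Variables (t n : nat).
Definition t_sets : {set {set 'I_n}} := [set e : {set 'I_n} | #|e| == t].

Lemma card_t_sets : #|t_sets| = 'C(n, t).
Proof. by rewrite card_draws card_ord. Qed.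

Lemma card_pair_t_sets (a b : 'I_n) : a != b ->
  (#|[set e in t_sets | (a \in e) && (b \in e)]| <= 'C(n - 2, t - 2))%N.
Proof.
move=> ab; pose A := [set a; b].
have cA : #|A| = 2 by rewrite cards2 ab.
have -> : 'C(n - 2, t - 2) = #|[set B : {set 'I_n} | (B \subset ~: A) && (#|B| == t - 2)%N]|.
  by rewrite cards_draws cardsCs setCK cA card_ord.
pose G := [set e in t_sets | (a \in e) && (b \in e)].
have GA e : e \in G -> A \subset e.
  by rewrite !inE subUset !sub1set => /and3P[_ -> ->].
have inj : {in G &, injective (fun e => e :\: A)}.
  move=> e e' /GA Ae /GA Ae' /= h.
  by rewrite -(setID e A) -(setID e' A) h (setIidPr Ae) (setIidPr Ae').
rewrite -(card_in_imset inj); apply/subset_leq_card/subsetP => _ /imsetP[e eG ->].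
rewrite inE cardsDS ?GA // cA; move: eG; rewrite !inE => /andP[/eqP -> _].
by rewrite eqxx andbT setDE subsetIr.
Qed.

Definition cycle_data j : {set {ffun 'I_j -> 'I_n} * {ffun 'I_j -> {set 'I_n}}} :=
  [set d : {ffun 'I_j -> 'I_n} * {ffun 'I_j -> {set 'I_n}} | injectiveb d.2 && [forall i, [&& d.2 i \in t_sets, d.1 i \in d.2 i,
     d.1 (ordS i) \in d.2 i & d.1 i != d.1 (ordS i)]]].

(** Indexed by traversals, so an edge set may occur repeatedly; repetitions only add factors at most
    1 to the product of [binom_E_avoid]. *)
Definition cycles j : seq {set {set 'I_n}} :=
  [seq [set d.2 i | i : 'I_j] | d : {ffun 'I_j -> 'I_n} * {ffun 'I_j -> {set 'I_n}}
    in cycle_data j].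

Lemma cyclesP j C : C \in cycles j -> C \subset t_sets /\ #|C| = j.
Proof.
case/mapP=> d; rewrite mem_enum inE => /andP[/injectiveP inj /forallP h] ->; split.
  by apply/subsetP=> _ /imsetP[i _ ->]; case/and4P: (h i).
by rewrite card_imset // card_ord.
Qed.

(** Once the [j] vertices are chosen, each edge has to contain two given distinct vertices. *)
Lemma size_cycles j : (size (cycles j) <= (n * 'C(n - 2, t - 2)) ^ j)%N.
Proof.
rewrite size_map -cardE.
pose A (v : {ffun 'I_j -> 'I_n}) i := [set e in t_sets |
  [&& v i \in e, v (ordS i) \in e & v i != v (ordS i)]].
have cA v i : (#|A v i| <= 'C(n - 2, t - 2))%N.
  have [e|ne] := eqVneq (v i) (v (ordS i)).
    rewrite (_ : A v i = set0) ?cards0 //; apply/setP=> f.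
    by rewrite !inE e eqxx !andbF.
  apply: leq_trans (card_pair_t_sets ne); apply/subset_leq_card/subsetP=> e.
  by rewrite !inE => /and4P[-> -> ->].
apply: (@leq_trans (\sum_(v : {ffun 'I_j -> 'I_n}) #|family (fun i => mem (A v i))|)).
  rewrite -sum1_card (eq_bigr (fun v => \sum_(f in family (fun i => mem (A v i))) 1)%N).
    rewrite pair_big_dep /= [leqRHS]big_mkcond [leqLHS]big_mkcond /=.
    apply: leq_sum => -[v f] _; rewrite inE /=; case: ifP => // /andP[_ /forallP h].
    rewrite ifT //; apply/familyP=> i; have /and4P[h1 h2 h3 h4] := h i.
    by rewrite !inE h2 h3 h4 !andbT; move: h1; rewrite inE.
  by move=> v _; rewrite sum1_card.
apply: (@leq_trans (\sum_(v : {ffun 'I_j -> 'I_n}) 'C(n - 2, t - 2) ^ j)).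
  apply: leq_sum => v _; rewrite card_family foldrE big_map big_enum /=.
  by rewrite -[X in (_ ^ X)%N]card_ord -prod_nat_const; apply: leq_prod => i _; apply: cA.
by rewrite sum_nat_const card_ffun !card_ord expnMn.
Qed.

Lemma no_short_cycle_avoid l (S : {set {set 'I_n}}) : S \subset t_sets ->
  (forall j C, (1 < j <= l)%N -> C \in cycles j -> ~~ (C \subset S)) ->
  no_short_cycle l S.
Proof.
move=> SU avoid j v f jl [inj fS vf vj].
pose d := ([ffun i : 'I_j => v i], [ffun i : 'I_j => f i]).
have := avoid j [set d.2 i | i : 'I_j] jl; rewrite /= => /(_ _)/negP; apply.
  apply/imageP; exists d => //; rewrite inE /=; apply/andP; split.
    apply/injectiveP=> a b; rewrite !ffunE => /inj; rewrite !inE !ltn_ord => /(_ isT isT).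
    exact: val_inj.
  apply/forallP=> i; rewrite !ffunE; have [v1 v2 v3] := vf i (ltn_ord i).
  have -> : v (ordS i) = v i.+1.
    rewrite /=; have := ltn_ord i; rewrite leq_eqVlt => /orP[/eqP e|lt].
      by rewrite e modnn vj.
    by rewrite modn_small.
  by rewrite v1 v2 v3 (subsetP SU) ?fS.
by apply/subsetP=> _ /imsetP[i _ ->]; rewrite ffunE fS.
Qed.

End UniformEdges.

(** The avoidance product is at least [exp] of minus twice the expected number of short traversals,
    and for each length [j] this number is at most [B ^ j]. *)
Lemma girth_bound (t n l : nat) (p B : R) :
  0 <= p <= 2^-1 -> 1 <= B -> (n * 'C(n - 2, t - 2))%:R * p <= B ->
  exp (- (2 * (l%:R * B ^+ l))) <=
    binom_E (t_sets t n) p (fun S => (pdec (no_short_cycle l S))%:R).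
Proof.
move=> /andP[p0 p2] B1 nB; have p01 : 0 <= p <= 1 by apply/andP; split=> //; lra.
pose Cs := flatten [seq cycles t n j | j <- iota 2 l.-1].
have CsP C : C \in Cs -> exists2 j, (1 < j <= l)%N & C \in cycles t n j.
  case/flatten_mapP=> j; rewrite mem_iota => jl jC; exists j => //; lia.
have CsU C : C \in Cs -> C \subset t_sets t n.
  by case/CsP=> j _ /cyclesP[].
have := binom_E_avoid p01 CsU (f := fun=> 1) (fun=> ler01) (fun _ _ _ => lexx 1).
rewrite binom_E1 // mulr1 => h.
have sub : forall S : {set {set 'I_n}}, S \subset t_sets t n ->
    (all (fun C : {set {set 'I_n}} => ~~ (C \subset S)) Cs)%:R * 1 <= (pdec (no_short_cycle l S))%:R :> R.
  move=> S SU; rewrite mulr1 ler_nat.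
  case: (boolP (all _ _)) => // /allP allC; rewrite lt0b; apply/pdecP.
  apply: (no_short_cycle_avoid SU) => j C jl jC; apply: allC.
  by apply/flatten_mapP; exists j; rewrite // mem_iota; lia.
apply: le_trans (le_binom_E p01 sub).
apply: le_trans h; apply: le_trans (exp_le_prod _); last first.
  move=> C /CsP[j jl jC]; have [_ ->] := cyclesP jC.
  rewrite exprn_ge0 //=; apply: le_trans p2; rewrite -[leRHS]expr1.
  by apply: ler_wiXn2l => //; [lra|lia].
apply: le_exp; rewrite lerN2 ler_pM2l ?ltr0n // big_flatten big_map /=.
apply: le_trans (_ : \sum_(j <- iota 2 l.-1) B ^+ l <= _); last first.
  rewrite big_const_seq count_predT size_iota iter_addr_0 -[leLHS]mulr_natl.
  by apply: ler_wpM2r; rewrite ?exprn_ge0 ?ler_nat ?leq_pred //; lra.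
rewrite big_seq [leRHS]big_seq; apply: ler_sum => j; rewrite mem_iota => jl.
have jl' : (j <= l)%N by lia.
apply: le_trans (ler_weXn2l B1 jl'); apply: le_trans (_ : ((n * 'C(n - 2, t - 2))%:R * p) ^+ j <= _).
  rewrite exprMn -natrX.
  apply: le_trans (_ : (size (cycles t n j))%:R * p ^+ j <= _).
    rewrite le_eqVlt; apply/orP; left; apply/eqP; rewrite big_seq.
    rewrite (eq_bigr (fun=> p ^+ j)); last by move=> C /cyclesP[_ ->].
    by rewrite -big_seq big_const_seq count_predT iter_addr_0 mulr_natl.
  by apply: ler_wpM2r; rewrite ?exprn_ge0 // ler_nat size_cycles.
by apply: lerXn2r; rewrite ?nnegrE ?mulr_ge0 //; lra.
Qed.

(** * First moment bound for small dense edge families *)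

Lemma expn_le_fact (k : nat) : k%:R ^+ k <= 3 ^+ k * k`!%:R :> R.
Proof.
elim: k => [|k IH]; first by rewrite !expr0 fact0 mulr1.
(* This is [(1 + 1/k) ^ k <= exp 1 <= 3]. *)
have step : k.+1%:R ^+ k <= 3 * k%:R ^+ k :> R.
  case: k {IH} => [|k]; first by rewrite !expr0; lra.
  have k0 : 0 < k.+1%:R :> R by rewrite ltr0n.
  have -> : k.+2%:R = (1 + k.+1%:R^-1) * k.+1%:R :> R.
    by rewrite mulrDl mulVf ?lt0r_neq0 // mul1r natr1.
  rewrite exprMn; apply: ler_wpM2r; first by rewrite exprn_ge0 // ltW.
  apply: le_trans (_ : exp (k.+1%:R^-1) ^+ k.+1 <= _).
    apply: lerXn2r; rewrite ?nnegrE ?exp_ge1D ?(ltW (exp_gt0 _)) //.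
    by rewrite addr_ge0 // invr_ge0 ltW.
  rewrite expRX (_ : k.+1%:R^-1 *+ k.+1 = 1); last first.
    by rewrite -[LHS]mulr_natr mulVf ?lt0r_neq0.
  by have /RleP := exp_le_3; rewrite !RealsE.
rewrite [leLHS]exprS [X in _ <= X * _]exprS factS natrM.
apply: le_trans (_ : k.+1%:R * (3 * (3 ^+ k * k`!%:R)) <= _).
  apply: ler_wpM2l; first exact: ler0n.
  by apply: le_trans step _; rewrite ler_pM2l // ltr0n.
by rewrite le_eqVlt; apply/orP; left; apply/eqP; ring.
Qed.

Lemma bin_le_pow (n k : nat) : 'C(n, k)%:R * k%:R ^+ k <= (3 * n%:R) ^+ k :> R.
Proof.
apply: le_trans (_ : 'C(n, k)%:R * (3 ^+ k * k`!%:R) <= _).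
  by apply: ler_wpM2l; rewrite ?ler0n ?expn_le_fact.
rewrite mulrCA -[X in _ * X <= _]natrM bin_ffact exprMn; apply: ler_wpM2l; first by rewrite exprn_ge0.
rewrite -natrX ler_nat ffact_prod -[X in (_ <= _ ^ X)%N]card_ord -prod_nat_const.
by apply: leq_prod => i _; apply: leq_subr.
Qed.

Lemma bin_ratio (n u t : nat) : (u <= n)%N -> ('C(u, t) * n ^ t <= 'C(n, t) * u ^ t)%N.
Proof.
move=> un; rewrite -(leq_pmul2r (fact_gt0 t)) mulnAC bin_ffact [leqRHS]mulnAC bin_ffact.
rewrite !ffact_prod -[X in (_ * n ^ X <= _)%N]card_ord -[X in (_ <= _ * u ^ X)%N]card_ord.
rewrite -!prod_nat_const -!big_split /=; apply: leq_prod => i _.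
rewrite !mulnBl [(n * u)%N]mulnC leq_sub2l // leq_mul2l un orbT //.
Qed.

(** With [a = Q (t - 1) - 1], only [u Q <= a f] is available, so [Q]-th powers are compared. For
    [r = u/n] the powers of [r] combine to [r ^ (Q + 1)], since [t Q = a + Q + 1], and stand against
    [(n/f) ^ Q]. As [r <= t f/n], one factor [f/n <= alpha] survives. *)
Lemma dense_term (t Q n f u : nat) (d theta alpha p : R) :
  (1 < t)%N -> (1 < Q)%N -> (0 < f)%N -> 0 <= d -> 0 <= p -> 0 <= theta ->
  f%:R <= alpha * n%:R -> alpha * t%:R <= 1 -> p * 'C(n, t)%:R <= d * n%:R ->
  3 ^+ (Q * (t - 1) - 1) * (3 * d) ^+ Q * t%:R ^+ Q.+1 * alpha <= theta ^+ Q ->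
  u = ((Q * (t - 1) - 1) * f %/ Q)%N ->
  'C(n, u)%:R * 'C('C(u, t), f)%:R * p ^+ f <= theta ^+ f.
Proof.
move=> t1 Q1 f0 d0 p0 th0 fn alt pN const; set a := (Q * (t - 1) - 1)%N => uE.
have f0R : 0 < f%:R :> R by rewrite ltr0n.
have Q0 : (0 < Q)%N by exact: ltnW.
have uQ : (u * Q <= a * f)%N by rewrite uE leq_divM.
have utf : (u <= t * f)%N.
  have : (a * f <= t * f * Q)%N.
    rewrite mulnAC leq_mul2r; apply/orP; right; rewrite /a.
    have : (Q * (t - 1) <= t * Q)%N by rewrite mulnC leq_mul2r leq_subr orbT.
    by move: (Q * (t - 1))%N (t * Q)%N => z z' h; clear -h; lia.
  by move/(leq_trans uQ); rewrite leq_pmul2r.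
have un : (u <= n)%N.
  apply: leq_trans utf _; rewrite -(ler_nat R) natrM.
  apply: le_trans (_ : t%:R * (alpha * n%:R) <= _); first by apply: ler_wpM2l; rewrite ?ler0n.
  by rewrite mulrA [_ * alpha]mulrC -[leRHS]mul1r ler_wpM2r ?ler0n.
have [Cu0|Cu_gt0] := posnP 'C(u, t).
  by rewrite Cu0 bin0n eqn0Ngt f0 mulr0 mul0r exprn_ge0.
have u0 : (0 < u)%N by move: Cu_gt0; rewrite bin_gt0; apply: leq_trans; exact: ltnW.
have n0 : (0 < n)%N by exact: leq_trans un.
have u0R : 0 < u%:R :> R by rewrite ltr0n.
have n0R : 0 < n%:R :> R by rewrite ltr0n.
pose r : R := u%:R / n%:R.
have r0 : 0 < r by rewrite divr_gt0.
have r1 : r <= 1 by rewrite ler_pdivrMr // mul1r ler_nat.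
have X_le : 'C(n, u)%:R <= (3 / r) ^+ u.
  have -> : 3 / r = 3 * n%:R / u%:R by rewrite /r invf_div mulrA.
  by rewrite expr_div_n ler_pdivlMr ?exprn_gt0 // bin_le_pow.
have Cp : 'C(u, t)%:R * p <= r ^+ t * (d * n%:R).
  apply: le_trans (_ : r ^+ t * 'C(n, t)%:R * p <= _); last first.
    by rewrite -mulrA; apply: ler_wpM2l; [rewrite exprn_ge0 // ltW|rewrite mulrC].
  apply: ler_wpM2r => //; rewrite /r expr_div_n mulrAC ler_pdivlMr ?exprn_gt0 //.
  by rewrite -!natrX -!natrM ler_nat [leqRHS]mulnC bin_ratio.
pose y := 3 * d * r ^+ t * n%:R / f%:R.
have y0 : 0 <= y.
  by rewrite /y !mulr_ge0 ?invr_ge0 ?exprn_ge0 ?ler0n // ltW.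
have Y_le : 'C('C(u, t), f)%:R * p ^+ f <= y ^+ f.
  apply: le_trans (_ : (3 * 'C(u, t)%:R / f%:R) ^+ f * p ^+ f <= _).
    apply: ler_wpM2r; first exact: exprn_ge0.
    by rewrite expr_div_n ler_pdivlMr ?exprn_gt0 // bin_le_pow.
  rewrite -exprMn; apply: lerXn2r; rewrite ?nnegrE //.
    by rewrite !mulr_ge0 ?invr_ge0 ?ler0n.
  rewrite mulrAC /y ler_pM2r ?invr_gt0 // -!mulrA ler_pM2l ?ltr0n //.
  by apply: le_trans Cp _; rewrite mulrCA.
have T0 : 0 <= 'C(n, u)%:R * 'C('C(u, t), f)%:R * p ^+ f :> R.
  by rewrite !mulr_ge0 ?ler0n ?exprn_ge0.
have T_le : 'C(n, u)%:R * 'C('C(u, t), f)%:R * p ^+ f <= (3 / r) ^+ u * y ^+ f.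
  by rewrite -mulrA; apply: ler_pM; rewrite ?mulr_ge0 ?ler0n ?exprn_ge0.
have r3 : 1 <= 3 / r by rewrite ler_pdivlMr // mul1r; lra.
rewrite -(ler_pXn2r Q0) ?nnegrE ?exprn_ge0 //.
apply: le_trans (lerXn2r Q _ _ T_le) _; rewrite ?nnegrE //.
  by rewrite mulr_ge0 ?exprn_ge0 // (le_trans _ r3) ?ler01.
rewrite exprMn -exprM -exprM mulnC.
apply: le_trans (_ : (3 / r) ^+ (a * f) * y ^+ (f * Q) <= _).
  by apply: ler_wpM2r; rewrite ?exprn_ge0 // ler_weXn2l // mulnC.
rewrite exprM [(f * Q)%N]mulnC exprM -exprMn -exprM [(f * Q)%N]mulnC exprM.
apply: lerXn2r; rewrite ?nnegrE ?exprn_ge0 ?mulr_ge0 ?exprn_ge0 ?(le_trans _ r3) ?ler01 //.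
apply: le_trans const.
have atQ : (t * Q = a + Q.+1)%N.
  rewrite /a mulnBr muln1 mulnC.
  have : (Q * 2 <= Q * t)%N by rewrite leq_mul2l t1 orbT.
  by clear -Q1; move: (Q * t)%N => z; lia.
have key (r' N : R) : r' != 0 -> (3 / r') ^+ a * (3 * d * r' ^+ t * N) ^+ Q =
    3 ^+ a * (3 * d) ^+ Q * (r' ^+ Q.+1 * N ^+ Q).
  move=> r'0; rewrite [(3 * d * r' ^+ t * N) ^+ Q]exprMn [(3 * d * r' ^+ t) ^+ Q]exprMn.
  rewrite -[(r' ^+ t) ^+ Q]exprM atQ exprD expr_div_n.
  have ra : r' ^+ a != 0 by rewrite expf_neq0.
  by field.
have -> : y = 3 * d * r ^+ t * (n%:R / f%:R) by rewrite /y mulrA.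
rewrite key ?lt0r_neq0 //.
rewrite -[leRHS]mulrA; apply: ler_wpM2l.
  by rewrite mulr_ge0 ?exprn_ge0 ?mulr_ge0 ?ler0n.
have rtf : r <= t%:R * (f%:R / n%:R).
  by rewrite mulrA /r ler_pM2r ?invr_gt0 // -natrM ler_nat.
have fn0 : 0 < f%:R / n%:R :> R by rewrite divr_gt0.
apply: le_trans (_ : (t%:R * (f%:R / n%:R)) ^+ Q.+1 * (n%:R / f%:R) ^+ Q <= _).
  apply: ler_wpM2r; first by rewrite exprn_ge0 // divr_ge0 // ler0n.
  apply: lerXn2r; rewrite ?nnegrE //; first exact: ltW.
  by apply: mulr_ge0; [exact: ler0n|exact: ltW].
rewrite exprMn -mulrA; apply: ler_wpM2l; first by rewrite exprn_ge0 ?ler0n.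
rewrite [_ ^+ Q.+1]exprS -mulrA -exprMn mulf_div [(n%:R * _)%R]mulrC.
by rewrite divff ?expr1n ?mulr1 ?mulf_neq0 ?lt0r_neq0 // ler_pdivrMr.
Qed.

Definition sparse_upto (V : finType) (Q t : nat) (x : R) (S : {set {set V}}) :=
  forall F : {set {set V}}, F \subset S -> #|F|%:R <= x ->
    ((Q * (t - 1) - 1) * #|F| <= Q * #|cover F|)%N.

Lemma card_bigcup (I T : finType) (P : pred I) (B : I -> {set T}) :
  (#|\bigcup_(i | P i) B i| <= \sum_(i | P i) #|B i|)%N.
Proof.
elim/big_ind2: _ => [|A x C y Ax Cy|//]; first by rewrite cards0.
by rewrite (leq_trans (leq_card_setU _ _)) // leq_add.
Qed.

(** The cover is enlarged to exactly [u] vertices, and then the [f] edges are chosen inside. *)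
Lemma card_covered (n t f u : nat) : (u <= n)%N ->
  (#|[set F : {set {set 'I_n}} | [&& F \subset t_sets t n, #|F| == f & (#|cover F| <= u)%N]]|
   <= 'C(n, u) * 'C('C(u, t), f))%N.
Proof.
move=> un.
pose tW (W : {set 'I_n}) := [set e : {set 'I_n} | (e \subset W) && (#|e| == t)].
pose B (W : {set 'I_n}) := [set F : {set {set 'I_n}} | (F \subset tW W) && (#|F| == f)].
apply: (@leq_trans #|\bigcup_(W : {set 'I_n} | #|W| == u) B W|).
  apply/subset_leq_card/subsetP=> F; rewrite inE => /and3P[FU cF covF].
  have W0E : exists2 W0 : {set 'I_n}, W0 \subset ~: cover F & #|W0| = (u - #|cover F|)%N.
    have h : (u - #|cover F| <= #|~: cover F|)%N.
      by rewrite [X in (_ <= X)%N]cardsCs setCK card_ord leq_sub2r.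
    by have [W0 ? ?] := exists_subset_card h; exists W0.
  have [W0 W0C cW0] := W0E; apply/bigcupP; exists (cover F :|: W0).
    rewrite cardsU cW0 disjoint_setI0 ?cards0 ?subn0 ?subnKC //.
    by rewrite disjoint_sym disjoints_subset.
  rewrite inE cF andbT; apply/subsetP=> e eF; rewrite inE.
  have := subsetP FU _ eF; rewrite inE => ->; rewrite andbT.
  by apply: subset_trans (subsetUl _ _); apply: bigcup_sup.
apply: leq_trans (card_bigcup _ _) _.
rewrite (eq_bigr (fun=> 'C('C(u, t), f))).
  by rewrite sum_nat_cond_const card_draws card_ord.
by move=> W /eqP cW; rewrite cards_draws cards_draws cW.
Qed.

Lemma geometric_bound (theta : R) k : 0 <= theta <= 2^-1 ->
  \sum_(i < k) theta ^+ i.+1 <= 2 * theta.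
Proof.
move=> /andP[th0 th2].
have : \sum_(i < k) theta ^+ i.+1 <= 2 * theta - 2 * theta ^+ k.+1.
  elim: k => [|k IH]; first by rewrite big_ord0 expr1 subrr.
  rewrite big_ord_recr /=; apply: le_trans (lerD IH (lexx _)) _.
  have pos : 0 <= theta ^+ k.+1 by exact: exprn_ge0.
  rewrite [theta ^+ k.+2]exprS; nra.
have : 0 <= theta ^+ k.+1 by exact: exprn_ge0.
lra.
Qed.

(** Union bound over the too dense families, grouped by size. The empty family is never too dense,
    so the geometric series starts at [theta]. *)
Lemma sparse_bound (t Q n : nat) (d theta alpha p : R) :
  (1 < t)%N -> (1 < Q)%N -> 0 <= d -> 0 <= p <= 1 -> 0 <= theta <= 2^-1 ->
  0 <= alpha -> alpha * t%:R <= 1 -> p * 'C(n, t)%:R <= d * n%:R ->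
  3 ^+ (Q * (t - 1) - 1) * (3 * d) ^+ Q * t%:R ^+ Q.+1 * alpha <= theta ^+ Q ->
  binom_E (t_sets t n) p (fun S => (~~ pdec (sparse_upto Q t (alpha * n%:R) S))%:R)
    <= 2 * theta.
Proof.
move=> t1 Q1 d0 p01 th alpha0 alt pN const; have /andP[p0 p1] := p01.
have /andP[th0 th2] := th.
set a := (Q * (t - 1) - 1)%N in const.
pose bad (F : {set {set 'I_n}}) := [&& F \subset t_sets t n, #|F|%:R <= alpha * n%:R
   & (Q * #|cover F| < a * #|F|)%N].
have le1 (S : {set {set 'I_n}}) : S \subset t_sets t n ->
    (~~ pdec (sparse_upto Q t (alpha * n%:R) S))%:R <=
    \sum_(F | bad F) (F \subset S)%:R * 1 :> R.
  move=> SU; have pos F : 0 <= (F \subset S)%:R * 1 :> R by rewrite mulr1 ler0n.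
  case: (pdecP (sparse_upto Q t (alpha * n%:R) S)) => [_|ns] /=; first exact: sumr_ge0.
  have [F [FS Fx Fd]] : exists F : {set {set 'I_n}},
      [/\ F \subset S, #|F|%:R <= alpha * n%:R & (Q * #|cover F| < a * #|F|)%N].
    apply: Classical_Prop.NNPP => no; apply: ns => F FS Fx; rewrite leqNgt.
    by apply/negP=> Fd; apply: no; exists F.
  have bF : bad F by rewrite /bad (subset_trans FS SU) Fx Fd.
  by rewrite (bigD1 F) //= FS mulr1 lerDl sumr_ge0.
apply: le_trans (le_binom_E p01 le1) _; rewrite binom_E_sum.
rewrite (eq_bigr (fun F : {set {set 'I_n}} => p ^+ #|F|)); last first.
  move=> F /and3P[FU _ _]; rewrite (binom_E_subset p (fun=> 1)) //.
  by rewrite binom_E1 // mulr1.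
apply: le_trans (geometric_bound #|t_sets t n| th).
rewrite (partition_big (fun F : {set {set 'I_n}} => inord #|F| : 'I_#|t_sets t n|.+1)
  xpredT) //= big_ord_recl /=.
rewrite [X in X + _]big1 ?add0r; last first.
  move=> F /andP[/and3P[FU Fx Fd] /eqP]; move/(congr1 val) => /=.
  rewrite inordK ?ltnS ?subset_leq_card // => F0.
  by move: Fd; rewrite F0 muln0.
apply: ler_sum => i _.
have [le_x|gt_x] := lerP (i.+1%:R) (alpha * n%:R); last first.
  rewrite big1 ?exprn_ge0 // => F /andP[/and3P[FU Fx Fd] /eqP /(congr1 val)] /=.
  rewrite inordK ?ltnS ?subset_leq_card // /bump leq0n add1n => F0.
  by move: Fx; rewrite F0 leNgt gt_x.
pose u := (a * i.+1 %/ Q)%N.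
have := dense_term t1 Q1 (ltn0Sn i) d0 p0 th0 le_x alt pN const (erefl u).
apply: le_trans.
have Q0 : (0 < Q)%N by exact: ltnW.
have un : (u <= n)%N.
  have utf : (u <= t * i.+1)%N.
    have : (a * i.+1 <= t * i.+1 * Q)%N.
      rewrite mulnAC leq_mul2r; apply/orP; right; rewrite /a.
      have : (Q * (t - 1) <= t * Q)%N by rewrite mulnC leq_mul2r leq_subr orbT.
      by move: (Q * (t - 1))%N (t * Q)%N => z z' h; clear -h; lia.
    by move=> h; rewrite -(leq_pmul2r Q0); apply: leq_trans h; exact: leq_divM.
  apply: leq_trans utf _; rewrite -(ler_nat R) natrM.
  apply: le_trans (_ : t%:R * (alpha * n%:R) <= _); first by apply: ler_wpM2l; rewrite ?ler0n.
  by rewrite mulrA [_ * alpha]mulrC -[leRHS]mul1r ler_wpM2r ?ler0n.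
pose G := [set F : {set {set 'I_n}} | [&& F \subset t_sets t n, #|F| == i.+1
   & (#|cover F| <= u)%N]].
apply: le_trans (_ : \sum_(F in G) p ^+ i.+1 <= _); last first.
  rewrite sumr_const -[leLHS]mulr_natl -natrM; apply: ler_wpM2r; first exact: exprn_ge0.
  by rewrite ler_nat card_covered.
rewrite big_mkcond [leRHS]big_mkcond; apply: ler_sum => F _.
case: ifP => [/andP[/and3P[FU Fx Fd] /eqP /(congr1 val)] /=|_]; last first.
  by case: ifP => // _; exact: exprn_ge0.
rewrite inordK ?ltnS ?subset_leq_card // /bump leq0n add1n => F0; rewrite F0 ifT //.
rewrite inE FU F0 eqxx /= leq_divRL // mulnC ltnW //.
by rewrite F0 in Fd.
Qed.

(** * Linearly many edges among at least quadratically many [t]-sets *)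

Lemma bin_pairs (n t : nat) : (1 < t)%N -> (1 < n)%N ->
  (n * (n - 1) * 'C(n - 2, t - 2) = t * (t - 1) * 'C(n, t))%N.
Proof.
case: t n => [|[|t]] // [|[|n]] // _ _; rewrite !subSS !subn0.
have := mul_bin_diag n.+2 t.+1; have := mul_bin_diag n.+1 t; rewrite /= => h1 h2.
by rewrite -mulnA h1 mulnCA h2 mulnCA mulnA.
Qed.

Lemma bin_ge_quadratic (n t : nat) : (1 < t)%N -> (t <= n)%N ->
  (n * (n - 1) <= t ^ 2 * 'C(n, t))%N.
Proof.
move=> t1 tn; have n1 : (1 < n)%N by exact: leq_trans tn.
apply: leq_trans (_ : n * (n - 1) * 'C(n - 2, t - 2) <= _)%N.
  by rewrite leq_pmulr // bin_gt0 leq_sub2r.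
rewrite bin_pairs // leq_mul2r expnS expn1; apply/orP; right.
by rewrite leq_mul2l leq_subr orbT.
Qed.

Lemma le_natr_bound (x : R) : exists N : nat, forall n : nat, (N <= n)%N -> x <= n%:R.
Proof.
exists (Num.bound `|x|) => n; rewrite -(ler_nat R) => le.
apply: le_trans (ler_norm x) _; apply: le_trans le; apply/ltW.
exact: archi_boundP.
Qed.

Lemma linear_le_bin (t : nat) (c : R) : (1 < t)%N ->
  exists N0 : nat, forall n : nat, (N0 <= n)%N -> c * n%:R <= 'C(n, t)%:R.
Proof.
move=> t1; have t0 : 0 < t%:R ^+ 2 :> R by rewrite exprn_gt0 // ltr0n ltnW.
have [N1 N1P] := le_natr_bound (c * t%:R ^+ 2 + 1)%R.
exists (maxn N1 t) => n; rewrite geq_max => /andP[/N1P cn tn].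
have n1 : (1 <= n)%N by apply: leq_trans tn; exact: ltnW.
have quad : n%:R * (n%:R - 1) <= t%:R ^+ 2 * 'C(n, t)%:R :> R.
  by rewrite -(natrB _ n1) -natrX -!natrM ler_nat bin_ge_quadratic.
rewrite -(ler_pM2l t0); apply: le_trans quad.
have -> : t%:R ^+ 2 * (c * n%:R) = n%:R * (c * t%:R ^+ 2) by ring.
by apply: ler_wpM2l; rewrite ?ler0n // lerBrDr.
Qed.

Lemma exp_N1_le : exp (-1) <= 2^-1.
Proof.
rewrite exp_N lef_pV2 ?posrE ?exp_gt0 //.
have := exp_ge1D 1; lra.
Qed.

Lemma half_pow_le (m : nat) : 2^-1 ^+ m <= (m.+1%:R)^-1 :> R.
Proof.
rewrite exprVn lef_pV2 ?posrE ?exprn_gt0 ?ltr0n // -natrX ler_nat.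
exact: ltn_expl.
Qed.

(** The mean being [4 m], one has [(1 - p/2) ^ N <= exp (- 2 m) <= 4 ^ (- m)], which beats
    [2 ^ m]. *)
Lemma lower_tail (N m : nat) (p : R) : 0 <= p -> p <= 1 -> p * N%:R = (4 * m)%:R ->
  2 ^+ m * (1 - p / 2) ^+ N <= (m.+1%:R)^-1.
Proof.
move=> p0 p1 pN; apply: le_trans (half_pow_le m).
have -> : 2^-1 ^+ m = 2 ^+ m * (2^-1 ^+ (2 * m)) :> R.
  by rewrite exprM -exprMn; congr (_ ^+ _); field.
apply: ler_wpM2l; first exact: exprn_ge0.
apply: le_trans (_ : exp (- (p / 2)) ^+ N <= _).
  apply: lerXn2r; rewrite ?nnegrE ?(ltW (exp_gt0 _)) ?exp_ge1D //; lra.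
rewrite expRX; have -> : (- (p / 2)) *+ N = (-1) *+ (2 * m).
  rewrite -[LHS]mulr_natr -[RHS]mulr_natr mulN1r mulNr; congr (- _).
  by rewrite mulrAC pN !natrM; field.
rewrite -expRX; apply: lerXn2r; rewrite ?nnegrE ?(ltW (exp_gt0 _)) ?exp_N1_le //.
by rewrite invr_ge0.
Qed.

Lemma sparse_girth_probability (t l Q : nat) (Delta : R) :
  (1 < t)%N -> (1 < Q)%N -> 0 < Delta ->
  exists alpha delta : R, [/\ 0 < alpha, 0 < delta & exists N0 : nat,
    forall n m : nat, (N0 <= n)%N -> m%:R <= Delta * n%:R -> Delta * n%:R <= m.+1%:R ->
    delta <= level_avg (t_sets t n) m (fun S =>
      (pdec (no_short_cycle l S /\ sparse_upto Q t (alpha * n%:R) S))%:R)].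
Proof.
move=> t1 Q1 D0; have t0 : 0 < t%:R :> R by rewrite ltr0n ltnW.
(* For the [p] chosen below, [n C(n-2,t-2) p = 4 m t (t-1) / (n-1)]; use [m <= Delta n] and
   [n <= 2 (n-1)]. *)
pose B := (1 + 8 * Delta * t%:R ^+ 2)%R.
pose d1 := (exp (- (2 * (l%:R * B ^+ l))))%R.
have tt0 : 0 < t%:R ^+ 2 :> R by exact: exprn_gt0.
have B1 : 1 <= B by rewrite /B lerDl (mulr_ge0 (mulr_ge0 (ler0n _ 8) (ltW D0)) (ltW tt0)).
have d1_gt0 : 0 < d1 by exact: exp_gt0.
have d1_le1 : d1 <= 1.
  rewrite -expR0 le_exp // oppr_le0 !mulr_ge0 ?ler0n ?exprn_ge0 //; lra.
(* Failure of sparsity then costs [2 theta = d1/4], the lower tail another [d1/4], and [d1/2]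
   remains. *)
pose theta := (d1 / 8)%R.
pose d := (4 * Delta)%R.
pose c := (3 ^+ (Q * (t - 1) - 1) * (3 * d) ^+ Q * t%:R ^+ Q.+1)%R.
have d0 : 0 < d by rewrite /d; lra.
have c0 : 0 < c by rewrite /c !mulr_gt0 ?exprn_gt0 ?mulr_gt0 ?ltr0n // ltnW.
have th0 : 0 < theta by rewrite /theta; lra.
have th1 : theta <= 2^-1 by rewrite /theta; lra.
have thQ : 0 < theta ^+ Q by exact: exprn_gt0.
have thQ1 : theta ^+ Q <= 1 by apply: exprn_ile1; lra.
pose alpha := (theta ^+ Q / (c + t%:R))%R.
have ct : 0 < c + t%:R by exact: addr_gt0.
have al0 : 0 < alpha by exact: divr_gt0.
have al_t : alpha * t%:R <= 1.
  rewrite /alpha mulrAC ler_pdivrMr // mul1r.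
  apply: le_trans (_ : 1 * t%:R <= _); first by rewrite ler_wpM2r // ltW.
  by rewrite mul1r lerDr ltW.
have al_c : c * alpha <= theta ^+ Q.
  rewrite /alpha mulrCA ger_pMr // ler_pdivrMr // mul1r lerDl ltW //.
exists alpha, (d1 / 2); split=> //; first by lra.
have [N1 N1P] := linear_le_bin (8 * Delta)%R t1.
have [N2 N2P] := le_natr_bound (4 / (d1 * Delta))%R.
exists (maxn (maxn N1 N2) (maxn t 2)) => n m; rewrite !geq_max => /and3P[/andP[n1 n2] nt n3].
move=> mn nm; have n0 : 0 < n%:R :> R by rewrite ltr0n; exact: leq_trans n3.
have n2R : 2 <= n%:R :> R by rewrite ler_nat.
pose N := 'C(n, t).
have N0 : 0 < N%:R :> R by rewrite ltr0n bin_gt0.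
have n1R : (n - 1)%:R = n%:R - 1 :> R by rewrite natrB // ltnW.
have mN8 : 8 * m%:R <= N%:R :> R.
  by apply: le_trans (N1P n n1); rewrite -mulrA ler_pM2l // ltr0n.
(* Four times the intended density, so that fewer than [m] edges are unlikely and the bound passes
   to level [m]. *)
pose p : R := ((4 * m)%:R / N%:R)%R.
have p0 : 0 <= p by rewrite divr_ge0 ?ler0n // ltW.
have p2 : p <= 2^-1 by rewrite ler_pdivrMr // natrM; lra.
have p01 : 0 <= p <= 1 by rewrite p0 /=; lra.
have pN : p * N%:R = (4 * m)%:R by rewrite /p divfK // lt0r_neq0.
have mle : (m <= #|t_sets t n|)%N.
  rewrite card_t_sets -(ler_nat R); have : 0 <= m%:R :> R by exact: ler0n.
  by rewrite -/N; lra.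
have girth := @girth_bound t n l p B _ B1 _.
have {}girth : d1 <= binom_E (t_sets t n) p (fun S => (pdec (no_short_cycle l S))%:R).
  apply: girth; first by rewrite p0.
  have nn1 : 0 < n%:R - 1 :> R by lra.
  have -> : (n * 'C(n - 2, t - 2))%:R = (t * (t - 1))%:R * N%:R / (n%:R - 1) :> R.
    apply/eqP; rewrite eq_sym (can2_eq (divfK _) (mulfK _)) ?lt0r_neq0 //.
    by rewrite -n1R -!natrM eqr_nat -bin_pairs // mulnAC.
  rewrite mulrAC -[X in X / _]mulrA [N%:R * _]mulrC pN.
  rewrite ler_pdivrMr //.
  have tt : (t * (t - 1))%:R <= t%:R ^+ 2 :> R.
    by rewrite -natrX ler_nat expnS expn1 leq_mul2l leq_subr orbT.
  apply: le_trans (_ : t%:R ^+ 2 * (4 * (Delta * n%:R)) <= _).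
    apply: ler_pM => //; try exact: ler0n.
    by rewrite natrM ler_pM2l // ltr0n.
  apply: le_trans (_ : (8 * Delta * t%:R ^+ 2) * (n%:R - 1) <= _); last first.
    by rewrite ler_wpM2r ?(ltW nn1) // /B lerDr ler01.
  have : 0 <= Delta * t%:R ^+ 2 by rewrite mulr_ge0 ?ltW.
  nra.
have sparse : binom_E (t_sets t n) p
    (fun S => (~~ pdec (sparse_upto Q t (alpha * n%:R) S))%:R) <= 2 * theta.
  apply: (@sparse_bound t Q n d theta alpha p) => //.
  - by rewrite /d; lra.
  - by rewrite ltW.
  - exact: ltW.
  - by rewrite pN natrM /d -mulrA ler_pM2l // ltr0n.
set f := (fun S : {set {set 'I_n}} => _).
have f01 S : 0 <= f S <= 1 by rewrite /f ler0n /= lern1 leq_b1.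
have fdec : antitone f.
  move=> S S' SS'; rewrite /f ler_nat; case: (pdecP (_ /\ _)) => // -[nc sp].
  rewrite lt0b; apply/pdecP; split; first exact: no_short_cycleS nc.
  by move=> F FS; apply: sp; apply: subset_trans SS'.
have tail := lower_tail p0 _ pN.
have := level_avg_ge p01 f01 fdec mle.
rewrite card_t_sets -/N; apply: le_trans.
have tail' : 2 ^+ m * (1 - p / 2) ^+ N <= d1 / 4.
  apply: le_trans (tail _) _; first by lra.
  have m0 : 0 < m.+1%:R :> R by rewrite ltr0n.
  rewrite -(ler_pM2r m0) mulVf ?lt0r_neq0 //.
  have := N2P n n2; rewrite ler_pdivrMr ?mulr_gt0 // => h.
  have : d1 / 4 * (Delta * n%:R) <= d1 / 4 * m.+1%:R.
    by rewrite ler_wpM2l // divr_ge0 // ltW.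
  lra.
have split_f : binom_E (t_sets t n) p (fun S => (pdec (no_short_cycle l S))%:R) <=
    binom_E (t_sets t n) p f + binom_E (t_sets t n) p
      (fun S => (~~ pdec (sparse_upto Q t (alpha * n%:R) S))%:R).
  rewrite -binom_ED; apply: (le_binom_E p01) => S _; rewrite /f -natrD ler_nat.
  case: pdecP => // nc; case: (pdecP (sparse_upto _ _ _ _)) => //= sp; last by rewrite leq_addl.
  by case: pdecP => // no; case: no.
rewrite /theta in sparse; lra.
Qed.

(** * Random instances *)

Section OutcomeCount.
Variables (t s n m : nat).
Local Notation label := (t.-tuple 'I_n * 'I_s)%type.
Implicit Types (g : outcome t s n) (A : {set 'I_n} -> {set label}).

Definition edge_labels (e : {set 'I_n}) : {set label} :=
  [set b : label | uniq b.1 && ([set x | x \in (b.1 : seq 'I_n)] == e)].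

Definition labels_in A g :=
  [forall e, if g e is Some b then b \in A e else true].

Lemma valid_outcomeE g : valid_outcome m g = (#|hyperedges g| == m) && labels_in edge_labels g.
Proof.
congr (_ && _); apply: eq_forallb => e.
by case: (g e) => [[tu G]|] //; rewrite inE.
Qed.

Lemma card_outcomes_with_support A (S : {set {set 'I_n}}) :
  #|[set g : outcome t s n | (hyperedges g == S) && labels_in A g]| = (\prod_(e in S) #|A e|)%N.
Proof.
pose F (e : {set 'I_n}) : pred (option label) :=
  if e \in S then (fun o => if o is Some b then b \in A e else false) else pred1 None.
transitivity #|family F|.
  apply: eq_card => g; rewrite inE; apply/andP/familyP => [[/eqP gS /forallP ok] e|gF].
    by rewrite /F -gS inE; have := ok e; case: (g e) => [b|].
  split; last first.
    by apply/forallP=> e; have := gF e; rewrite /F; case: ifP => _; case: (g e).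
  apply/eqP/setP=> e; rewrite inE; have := gF e; rewrite /F.
  by case: ifP => _; case: (g e).
rewrite card_family foldrE big_map big_enum /= [RHS]big_mkcond; apply: eq_bigr => e _.
rewrite /F; case: ifP => _; last by rewrite card1.
have Some_i : injective (@Some label) by move=> x y [].
rewrite -(card_imset _ Some_i); apply: eq_card => -[b|].
  by rewrite [LHS]/in_mem /= mem_imset.
by apply/esym/imsetP; case.
Qed.

Lemma card_outcomes A (P : pred {set {set 'I_n}}) :
  #|[set g : outcome t s n | [&& #|hyperedges g| == m, P (hyperedges g) & labels_in A g]]| =
  (\sum_(S : {set {set 'I_n}} | (#|S| == m) && P S) \prod_(e in S) #|A e|)%N.
Proof.
rewrite -sum1_card (partition_big (@hyperedges t s n) (fun S => (#|S| == m) && P S)) /=.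
  apply: eq_bigr => S /andP[cS PS]; rewrite -card_outcomes_with_support -sum1_card.
  apply: eq_bigl => g; rewrite !inE; case: (eqVneq (hyperedges g) S) => [->|_].
    by rewrite cS PS /= andbT.
  by rewrite andbF.
by move=> g; rewrite inE => /and3P[-> ->].
Qed.

Lemma card_orderings (e : {set 'I_n}) : #|e| = t ->
  #|[set tu : t.-tuple 'I_n | uniq tu && ([set x | x \in (tu : seq 'I_n)] == e)]| = t`!.
Proof.
move=> et; have -> : t`! = #|e| ^_ t by rewrite et ffactnn.
rewrite -(card_uniq_tuples t (mem e)).
apply: eq_card => tu; rewrite !inE andbC; case: (boolP (uniq tu)) => [u|]; last first.
  by rewrite !andbF.
rewrite !andbT; apply/eqP/allP => [<- x xt|sub]; first by rewrite !inE.
apply/eqP; rewrite eqEcard et; apply/andP; split.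
  by apply/subsetP=> x; rewrite inE => /sub.
by rewrite cardsE (card_uniqP u) size_tuple.
Qed.

Lemma edge_labels_setX (e : {set 'I_n}) : edge_labels e =
  setX [set tu : t.-tuple 'I_n | uniq tu && ([set x | x \in (tu : seq 'I_n)] == e)] setT.
Proof. by apply/setP=> -[tu G]; rewrite !inE andbT. Qed.

Lemma card_edge_labels (e : {set 'I_n}) : #|e| = t -> #|edge_labels e| = (t`! * s)%N.
Proof. by move=> et; rewrite edge_labels_setX cardsX card_orderings // cardsT card_ord. Qed.

Lemma edge_labels_t_sets (e : {set 'I_n}) : e \notin t_sets t n -> edge_labels e = set0.
Proof.
rewrite inE => et; apply/setP=> -[tu G]; rewrite !inE /=.
apply/negP=> /andP[u /eqP E]; case/negP: et; rewrite -E cardsE (card_uniqP u).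
by rewrite size_tuple.
Qed.

Hypothesis s_gt0 : (0 < s)%N.
Let W : R := (t`! * s)%:R.

Lemma label_count_gt0 : 0 < W.
Proof. by rewrite ltr0n muln_gt0 fact_gt0. Qed.

(** Every [t]-set has the same number [W] of labels. Hence the edge set of a random outcome is
    uniform and its labels are independent, which gives the product. *)
Lemma card_outcomes_level A (P : pred {set {set 'I_n}}) :
  (forall e, A e \subset edge_labels e) ->
  #|[set g : outcome t s n | [&& #|hyperedges g| == m, P (hyperedges g) & labels_in A g]]|%:R =
  W ^+ m * level (t_sets t n) m
    (fun S => (P S)%:R * \prod_(e in S) (#|A e|%:R / W)) :> R.
Proof.
move=> AE; rewrite card_outcomes natr_sum /level big_distrr /=.
rewrite big_mkcond [RHS]big_mkcond; apply: eq_bigr => S _.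
have W0 := lt0r_neq0 label_count_gt0.
case: (boolP (S \subset t_sets t n)) => [SU|/subsetPn[e eS eU]] /=.
  case: (eqVneq #|S| m) => [<-|] //=; case: (P S); rewrite ?mul0r ?mulr0 //= mul1r.
  rewrite natr_prod -prodr_const -big_split /=; apply: eq_bigr => e _.
  by rewrite mulrCA mulfV ?mulr1.
case: ifP => // _; rewrite (bigD1 e) //=.
have -> : A e = set0.
  by apply/eqP; rewrite -subset0 -(edge_labels_t_sets eU).
by rewrite cards0 mul0n.
Qed.

Lemma card_valid_outcomes :
  #|[set g : outcome t s n | valid_outcome m g]|%:R = W ^+ m * 'C('C(n, t), m)%:R :> R.
Proof.
have := @card_outcomes_level edge_labels predT (fun e => subxx _).
rewrite (_ : [set g | _] = [set g | valid_outcome m g]); last first.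
  by apply/setP=> g; rewrite !inE valid_outcomeE.
move=> ->; congr (_ * _); rewrite -(card_t_sets t n) -(level1 R).
apply: eq_bigr => S /andP[SU _]; rewrite mul1r big1 // => e eS.
rewrite card_edge_labels ?divff ?lt0r_neq0 ?label_count_gt0 //.
by have := subsetP SU _ eS; rewrite inE => /eqP.
Qed.

Lemma prob_ge_level (E : ('I_s -> {set t.-tuple 'I_n}) -> Prop)
  (P : {set {set 'I_n}} -> Prop) : (m <= 'C(n, t))%N ->
  (forall g : outcome t s n, valid_outcome m g -> P (hyperedges g) -> E (inst_of g)) ->
  level_avg (t_sets t n) m (fun S => (pdec (P S))%:R) <= prob n m E.
Proof.
move=> mN PE; rewrite /prob !RealsE card_valid_outcomes.
have C0 : 0 < 'C('C(n, t), m)%:R :> R by rewrite ltr0n bin_gt0.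
have W0 : 0 < W ^+ m by rewrite exprn_gt0 ?label_count_gt0.
rewrite ler_pdivlMr ?mulr_gt0 // /level_avg card_t_sets mulrCA divfK ?lt0r_neq0 //.
have := @card_outcomes_level edge_labels (fun S => pdec (P S)) (fun e => subxx _).
set X := #|_| => XE.
have -> : W ^+ m * level (t_sets t n) m (fun S => (pdec (P S))%:R) = X%:R.
  rewrite XE; congr (_ * _); apply: eq_bigr => S /andP[SU _].
  rewrite [X in _ * X]big1 ?mulr1 // => e eS.
  rewrite card_edge_labels ?divff ?lt0r_neq0 ?label_count_gt0 //.
  by have := subsetP SU _ eS; rewrite inE => /eqP.
rewrite ler_nat; apply/subset_leq_card/subsetP=> g; rewrite !inE.
case/and3P=> gm /pdecP gP gl; have gv : valid_outcome m g by rewrite valid_outcomeE gm.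
by rewrite gv; apply/pdecP; apply: PE.
Qed.

Variables (D : finType) (RT : 'I_s -> {set t.-tuple D}).

Definition sat_labels (h : 'I_n -> D) (e : {set 'I_n}) : {set label} :=
  [set b : label in edge_labels e | map_tuple h b.1 \in RT b.2].

Lemma hom_labels_in (h : 'I_n -> D) g : valid_outcome m g -> is_hom (inst_of g) RT h ->
  labels_in (sat_labels h) g.
Proof.
rewrite valid_outcomeE => /andP[_ /forallP gl] hom; apply/forallP=> e.
have := gl e; case ge: (g e) => [[tu G]|] // el; rewrite inE el /=.
by apply: hom; rewrite inE; apply/existsP; exists e; rewrite ge.
Qed.

(** Union bound over assignments; for a given edge set, the product is the probability that the
    labels of all edges are satisfied. *)
Lemma prob_unsat_ge : (m <= 'C(n, t))%N ->
  1 - level_avg (t_sets t n) m (fun S => \sum_(h : {ffun 'I_n -> D})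
        \prod_(e in S) (#|sat_labels h e|%:R / W)) <=
  prob n m (fun RA => ~ exists h : 'I_n -> D, is_hom RA RT h).
Proof.
move=> mN; rewrite /prob !RealsE card_valid_outcomes.
have C0 : 0 < 'C('C(n, t), m)%:R :> R by rewrite ltr0n bin_gt0.
have W0 : 0 < W ^+ m by rewrite exprn_gt0 ?label_count_gt0.
rewrite ler_pdivlMr ?mulr_gt0 // mulrBl mul1r -card_valid_outcomes.
rewrite lerBlDr [in leRHS]addrC /level_avg card_t_sets card_valid_outcomes.
rewrite mulrCA divfK ?lt0r_neq0 //.
rewrite -card_valid_outcomes.
have -> : W ^+ m * level (t_sets t n) m (fun S => \sum_(h : {ffun 'I_n -> D})
    \prod_(e in S) (#|sat_labels h e|%:R / W)) =
  \sum_(h : {ffun 'I_n -> D}) #|[set g : outcome t s n |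
    [&& #|hyperedges g| == m, predT (hyperedges g) & labels_in (sat_labels h) g]]|%:R.
  rewrite /level exchange_big big_distrr /=; apply: eq_bigr => h _.
  have sub e : sat_labels h e \subset edge_labels e.
    by apply/subsetP=> b; rewrite inE => /andP[].
  apply/esym; apply: etrans (@card_outcomes_level _ predT sub) _.
  by congr (_ * _); apply: eq_bigr => S _; rewrite mul1r.
rewrite -natr_sum -natrD ler_nat.
pose V := [set g : outcome t s n | valid_outcome m g].
pose Y (h : {ffun 'I_n -> D}) := [set g : outcome t s n |
  [&& #|hyperedges g| == m, predT (hyperedges g) & labels_in (sat_labels h) g]].
pose Z := [set g : outcome t s n | valid_outcome m g &&
  pdec (~ exists h : 'I_n -> D, is_hom (inst_of g) RT h)].
apply: (@leq_trans #|(\bigcup_(h : {ffun 'I_n -> D}) Y h) :|: Z|).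
  apply/subset_leq_card/subsetP=> g; rewrite [g \in [set _ | _]]inE => gv.
  rewrite inE [g \in Z]inE gv /=; case: pdecP => [|hom]; first by rewrite orbT.
  have [h homh] := Classical_Prop.NNPP _ hom; rewrite orbF.
  apply/bigcupP; exists [ffun x => h x] => //; rewrite inE.
  have := gv; rewrite valid_outcomeE => /andP[-> _] /=.
  apply: hom_labels_in => // G tu tuG; have := homh G tu tuG.
  suff -> : map_tuple [ffun x => h x] tu = map_tuple h tu by [].
  by apply: eq_from_tnth => i; rewrite !tnth_map ffunE.
apply: leq_trans (leq_card_setU _ _) _; rewrite leq_add2r.
exact: card_bigcup.
Qed.

End OutcomeCount.

(** * First moment bound on the number of homomorphisms *)

Lemma bin_mono_class (n u d t : nat) : (n <= u * d)%N -> (2 * d * t <= n)%N ->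
  ('C(n, t) <= (2 * d) ^ t * 'C(u, t))%N.
Proof.
move=> nud dtn; rewrite -(leq_pmul2r (fact_gt0 t)) bin_ffact -mulnA bin_ffact.
rewrite !ffact_prod -[X in (_ <= _ ^ X * _)%N]card_ord -prod_nat_const -big_split /=.
(* Factor by factor [n <= 2 d (u - i)], from [2 n <= 2 d u] and [2 d i <= n]. *)
apply: leq_prod => i _; apply: leq_trans (leq_subr _ _) _.
rewrite mulnBr.
have : (2 * d * i <= 2 * d * t)%N by rewrite leq_mul2l (ltnW (ltn_ord i)) orbT.
move: (2 * d * i)%N => z zt; have : (2 * n <= 2 * d * u)%N.
  by rewrite -mulnA leq_mul2l mulnC nud.
by move: (2 * d * u)%N (2 * d * t)%N zt dtn => a b; clear; lia.
Qed.

Lemma large_class (n : nat) (D : finType) (h : 'I_n -> D) : (0 < #|D|)%N ->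
  exists i : D, (n <= #|[set x | h x == i]| * #|D|)%N.
Proof.
move=> D0; apply/existsP; rewrite -[[exists _, _]]negbK; apply/negP.
rewrite negb_exists => /forallP small.
have tot : (\sum_(i : D) #|[set x | h x == i]| = n)%N.
  rewrite -[RHS]card_ord -sum1_card (partition_big h xpredT) //=.
  by apply: eq_bigr => i _; rewrite -sum1_card; apply: eq_bigl => x; rewrite inE.
have [i0 _] : exists i0 : D, i0 \in D by apply/card_gt0P.
have : (\sum_(i : D) #|[set x | h x == i]| * #|D| < \sum_(i : D) n)%N.
  rewrite (bigD1 i0) // [X in (_ < X)%N](bigD1 i0) //= -addSn leq_add //.
    by rewrite ltnNge small.
  by apply: leq_sum => i _; rewrite leqNgt; apply/negP=> lt; move: (small i); rewrite ltnW.
by rewrite -big_distrl /= tot sum_nat_const mulnC ltnn.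
Qed.

Lemma not_trivially_satisfiableP (t s : nat) (D : finType) (RT : 'I_s -> {set t.-tuple D}) :
  ~ trivially_satisfiable RT -> forall i : D, exists G, [tuple i | _ < t] \notin RT G.
Proof.
move=> nt i; apply: Classical_Prop.NNPP => no; apply: nt; exists i => n RA _ G tu _.
have -> : map_tuple (fun=> i) tu = [tuple i | _ < t].
  by apply: eq_from_tnth => j; rewrite tnth_map tnth_mktuple.
by apply/negPn/negP => h; apply: no; exists G.
Qed.

Section Unsatisfiable.
Variables (t s : nat) (D : finType) (RT : 'I_s -> {set t.-tuple D}).
Hypotheses (t_gt1 : (1 < t)%N) (s_gt0 : (0 < s)%N) (D_gt0 : (0 < #|D|)%N).
Hypothesis RT_nontrivial : forall i : D, exists G, [tuple i | _ < t] \notin RT G.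

Definition edge_wt n (h : 'I_n -> D) (e : {set 'I_n}) : R :=
  #|sat_labels RT h e|%:R / (t`! * s)%:R.

Lemma edge_wt_ge0 n (h : 'I_n -> D) e : 0 <= edge_wt h e.
Proof. by rewrite divr_ge0 ?ler0n. Qed.

Lemma sat_labels_sub n (h : 'I_n -> D) e : sat_labels RT h e \subset edge_labels t s e.
Proof. by apply/subsetP=> b; rewrite inE => /andP[]. Qed.

Lemma edge_wt_le1 n (h : 'I_n -> D) e : edge_wt h e <= 1.
Proof.
rewrite ler_pdivrMr ?label_count_gt0 // mul1r ler_nat.
have [et|et] := boolP (e \in t_sets t n); last first.
  by have := sat_labels_sub h e; rewrite edge_labels_t_sets // subset0 => /eqP ->; rewrite cards0.
rewrite -(@card_edge_labels t s n e); first exact/subset_leq_card/sat_labels_sub.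
by move: et; rewrite inE => /eqP.
Qed.

(** Every ordering of a monochromatic edge is mapped to the constant tuple, which at least one of
    the [s] symbols rejects. *)
Lemma edge_wt_mono n (h : 'I_n -> D) (i : D) e : e \in t_sets t n ->
  e \subset [set x | h x == i] -> edge_wt h e <= 1 - s%:R^-1.
Proof.
rewrite inE => /eqP et /subsetP mono; have [G nG] := RT_nontrivial i.
pose O := [set tu : t.-tuple 'I_n | uniq tu && ([set x | x \in (tu : seq 'I_n)] == e)].
have sub : sat_labels RT h e \subset setX O [set~ G].
  apply/subsetP=> -[tu G']; rewrite !inE /= => /andP[ue hG]; rewrite ue /=.
  apply: contra nG => /eqP <-; suff <- : map_tuple h tu = [tuple i | _ < t] by [].
  apply: eq_from_tnth => j; rewrite tnth_map tnth_mktuple.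
  have /andP[_ /eqP tue] := ue; have := mono (tnth tu j).
  by rewrite -tue !inE mem_tnth => /(_ isT)/eqP.
have card_le : (#|sat_labels RT h e| <= t`! * (s - 1))%N.
  apply: leq_trans (subset_leq_card sub) _.
  by rewrite cardsX card_orderings // cardsC1 card_ord subn1.
have s0 : 0 < s%:R :> R by rewrite ltr0n.
rewrite ler_pdivrMr ?label_count_gt0 // natrM mulrCA mulrBl mul1r mulVf ?lt0r_neq0 //.
by rewrite -[1]/(1%:R) -natrB // -natrM ler_nat.
Qed.

(** Some value is taken on at least [n / |D|] vertices. At least a fraction [(2 |D|) ^ (- t)] of the
    [t]-sets lies in that class, and each of them contributes a factor [exp (- p/s)]. *)
Lemma unsat_product n (h : 'I_n -> D) (p : R) : 0 <= p <= 1 -> (2 * #|D| * t <= n)%N ->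
  \prod_(e in t_sets t n) (1 - p + p * edge_wt h e) <=
  exp (- (p * 'C(n, t)%:R / (s%:R * (2 * #|D|)%:R ^+ t))).
Proof.
move=> /andP[p0 p1] nD; have [i iP] := large_class h D_gt0.
pose V := [set x | h x == i].
have s0 : 0 < s%:R :> R by rewrite ltr0n.
pose M := [set e in t_sets t n | e \subset V].
have cM : #|M| = 'C(#|V|, t).
  by rewrite -cards_draws; apply: eq_card => e; rewrite !inE andbC.
have fac e : 0 <= 1 - p + p * edge_wt h e <= 1.
  have w0 := edge_wt_ge0 h e; have w1 := edge_wt_le1 h e.
  by apply/andP; split; nra.
apply: le_trans (_ : \prod_(e in M) exp (- (p / s%:R)) <= _).
  rewrite (big_setID M) /= (setIidPr _); last by apply/subsetP=> e; rewrite inE => /andP[].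
  rewrite -[leRHS]mulr1; apply: ler_pM.
  - by apply: prodr_ge0 => e _; case/andP: (fac e).
  - by apply: prodr_ge0 => e _; case/andP: (fac e).
  - apply: ler_prod => e; rewrite inE => /andP[eU eV]; case/andP: (fac e) => -> _ /=.
    apply: le_trans (exp_ge1D _); have := edge_wt_mono eU eV; move: (edge_wt h e) => w ws.
    by have : p * w <= p * (1 - s%:R^-1) by [exact: ler_wpM2l]; rewrite mulrBr; lra.
  - by apply: prodr_ile1 => e _; apply: fac.
rewrite prodr_const expRX cM; apply: le_exp; rewrite mulNrn lerN2 -[leRHS]mulr_natr.
have d0 : 0 < (2 * #|D|)%:R ^+ t :> R by rewrite exprn_gt0 // ltr0n muln_gt0.
rewrite ler_pdivrMr ?mulr_gt0 // [p / _ * _]mulrAC mulrA divfK ?lt0r_neq0 //.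
rewrite -mulrA; apply: ler_wpM2l => //.
by rewrite mulrC -natrX -natrM ler_nat bin_mono_class.
Qed.

(** For [k = 2 s (2 |D|) ^ t] an assignment has weight at most [exp (- m/k)] in expectation. The
    choice [Delta = k (|D| + 1)] beats the number [|D| ^ n <= exp (|D| n)] of assignments and leaves
    [exp (1 - n)], where the 1 absorbs the rounding of [Delta n]. *)
Lemma unsat_level (eps : R) : 0 < eps ->
  let Delta := (2 * s * (2 * #|D|) ^ t * (#|D| + 1))%:R : R in
  exists N0 : nat, forall n m : nat, (N0 <= n)%N ->
    m%:R <= Delta * n%:R -> Delta * n%:R <= m.+1%:R ->
    level_avg (t_sets t n) m (fun S => \sum_(h : {ffun 'I_n -> D})
      \prod_(e in S) edge_wt h e) <= eps.
Proof.
move=> eps0; set kn := (2 * s * (2 * #|D|) ^ t)%N; set Delta := _%:R => /=.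
have kn0 : (0 < kn)%N by rewrite !muln_gt0 s_gt0 expn_gt0 muln_gt0 D_gt0.
pose k : R := (kn%:R)%R.
have k1 : 1 <= k by rewrite ler1n.
have k0 : 0 < k by rewrite ltr0n.
have DE : Delta = k * (#|D|%:R + 1) by rewrite /Delta natrM natrD.
have [N1 N1P] := linear_le_bin Delta t_gt1.
have [N2 N2P] := le_natr_bound (2 / eps)%R.
exists (maxn (maxn N1 N2) (maxn (2 * #|D| * t) (maxn t 2))) => n m.
rewrite !geq_max => /andP[/andP[n1 n2] /and3P[nD nt n3]] mn nm.
have n0 : 0 < n%:R :> R by rewrite ltr0n; exact: leq_trans n3.
have n2R : 2 <= n%:R :> R by rewrite ler_nat.
pose N := 'C(n, t).
have N0 : 0 < N%:R :> R by rewrite ltr0n bin_gt0.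
have D1 : 1 <= #|D|%:R :> R by rewrite ler1n.
have Delta2 : 2 <= Delta.
  rewrite DE; apply: le_trans (_ : 1 * 2 <= _); first by rewrite mul1r.
  by apply: ler_pM => //; lra.
have m0 : 0 < m%:R :> R.
  have : 2 * 2 <= Delta * n%:R by apply: ler_pM.
  by rewrite -natr1 in nm; lra.
have mN : m%:R <= N%:R :> R by exact: le_trans (N1P n n1).
(* Half the intended density: by Markov at most [m] edges appear with probability at least one half,
   so the transfer costs a factor 2. *)
pose p : R := (m%:R / (2 * N%:R))%R.
have p0 : 0 <= p by rewrite divr_ge0 ?mulr_ge0 ?ler0n // ltW.
have p1 : p <= 1 by rewrite ler_pdivrMr ?mulr_gt0 // mul1r; lra.
have p01 : 0 <= p <= 1 by rewrite p0.
have pN : p * N%:R = m%:R / 2 by rewrite /p; field; rewrite lt0r_neq0.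
set f := (fun S : {set {set 'I_n}} => _).
have f0 S : 0 <= f S.
  by apply: sumr_ge0 => h _; apply: prodr_ge0 => e _; apply: edge_wt_ge0.
have fdec : antitone f.
  move=> S S' SS'; apply: ler_sum => h _.
  rewrite (big_setID S) /= (setIidPr SS') -[leRHS]mulr1; apply: ler_wpM2l.
    by apply: prodr_ge0 => e _; apply: edge_wt_ge0.
  by apply: prodr_ile1 => e _; rewrite edge_wt_ge0 edge_wt_le1.
have mle : (m <= #|t_sets t n|)%N by rewrite card_t_sets -(ler_nat R).
have markov : binom_E (t_sets t n) p (fun S => (m < #|S|)%:R) <= 2^-1.
  apply: le_trans (binom_E_markov _ p01 m0) _.
  by rewrite card_t_sets pN mulrAC mulfV ?lt0r_neq0 // mul1r.
have avg0 : 0 <= level_avg (t_sets t n) m f by rewrite divr_ge0 ?ler0n // level_ge0.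
have avg_le : level_avg (t_sets t n) m f <= 2 * binom_E (t_sets t n) p f.
  have := level_avg_le p01 f0 fdec mle.
  move: (level_avg _ _ _) (binom_E _ _ f) avg0 (binom_E _ _ _) markov => x y x0 z z2.
  by have : x * 2^-1 <= x * (1 - z) by [apply: ler_wpM2l => //; lra]; lra.
have Ef : binom_E (t_sets t n) p f <= exp (1 - n%:R).
  rewrite binom_E_sum.
  apply: le_trans (_ : \sum_(h : {ffun 'I_n -> D}) exp (- (m%:R / k)) <= _).
    apply: ler_sum => h _; rewrite binom_E_prod; apply: le_trans (unsat_product h p01 nD) _.
    rewrite le_eqVlt; apply/orP; left; apply/eqP; congr exp; congr (- _).
    have E0 : (2 * #|D|)%:R != 0 :> R by rewrite pnatr_eq0 -lt0n muln_gt0 D_gt0.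
    have s0 : s%:R != 0 :> R by rewrite pnatr_eq0 -lt0n.
    rewrite -/N pN /k /kn; move: (2 * #|D|)%N E0 => E E0; rewrite !natrM natrX.
    by field; rewrite s0 expf_neq0.
  rewrite sumr_const card_ffun card_ord -[leLHS]mulr_natl natrX.
  apply: le_trans (_ : exp (#|D|%:R) ^+ n * exp (- (m%:R / k)) <= _).
    apply: ler_wpM2r; first exact/ltW/exp_gt0.
    apply: lerXn2r; rewrite ?nnegrE ?ler0n ?(ltW (exp_gt0 _)) //.
    by apply: le_trans (exp_ge1D _); rewrite lerDr ler01.
  rewrite expRX expRD; apply: le_exp; rewrite -[X in X + _ <= _]mulr_natr.
  have : (#|D|%:R + 1) * n%:R - 1 <= m%:R / k.
    rewrite ler_pdivlMr // mulrBl mul1r.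
    have -> : (#|D|%:R + 1) * n%:R * k = Delta * n%:R by rewrite DE; ring.
    by rewrite -natr1 in nm; lra.
  by rewrite mulrDl mul1r => h; lra.
have en : exp (1 - n%:R) <= n%:R^-1.
  have -> : 1 - n%:R = - (n%:R - 1) :> R by rewrite opprB.
  rewrite exp_N lef_pV2 ?posrE ?exp_gt0 //.
  by have := exp_ge1D (n%:R - 1); rewrite addrC subrK.
apply: le_trans avg_le _; apply: le_trans (_ : 2 * n%:R^-1 <= _).
  by rewrite ler_pM2l ?ltr0n // (le_trans Ef).
by rewrite ler_pdivrMr // mulrC -ler_pdivrMr //; exact: N2P.
Qed.

End Unsatisfiable.

(** * Rounding and assembly *)

Lemma floorR_bounds (x : R) : 0 <= x -> (floorR x)%:R <= x /\ x <= (floorR x).+1%:R.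
Proof.
move=> x0; have [/RleP lo hi] := base_Int_part x.
have {}hi : x < IZR (Int_part x) + 1 
  by apply/RltP; change (Rlt x (Rplus (IZR (Int_part x)) R1)); Lra.lra.
have z0 : Z.le Z0 (Int_part x).
  have [neg|//] := ZArith_dec.Z_lt_le_dec (Int_part x) Z0.
  have := IZR_le _ _ (Zorder.Zlt_le_succ _ _ neg); rewrite succ_IZR => /RleP.
  by rewrite !RealsE => h; exfalso; lra.
have fE : (floorR x)%:R = IZR (Int_part x).
  by rewrite -INRE INR_IZR_INZ /floorR Znat.Z2Nat.id.
split; first by rewrite fE.
by rewrite -natr1 fE ltW.
Qed.

Lemma inst_of_is_instance (t s n m : nat) (g : outcome t s n) :
  valid_outcome m g -> is_instance (inst_of g).
Proof.
case/andP=> _ /forallP gl G tu; rewrite inE => /existsP[e /eqP ge].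
by have := gl e; rewrite ge => /andP[].
Qed.

Lemma prob_both (t s n m : nat) (E1 E2 : ('I_s -> {set t.-tuple 'I_n}) -> Prop) :
  1 < prob n m E1 + prob n m E2 ->
  exists g : outcome t s n, [/\ valid_outcome m g, E1 (inst_of g) & E2 (inst_of g)].
Proof.
move=> gt1; apply: Classical_Prop.NNPP => no; move: gt1; rewrite ltNge => /negP; apply.
rewrite /prob !RealsE -mulrDl -natrD.
set X := #|_|; set Y := #|_|; set V := #|_|.
have le : (X + Y <= V)%N.
  rewrite /X /Y -cardsUI [X in (_ + X)%N](_ : _ = 0%N) ?addn0.
    by apply/subset_leq_card/subsetP=> g; rewrite !inE => /orP[] /andP[].
  apply/eqP; rewrite cards_eq0; apply/eqP/setP=> g; rewrite !inE; apply/negP.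
  by case/andP=> /andP[gv /pdecP h1] /andP[_ /pdecP h2]; apply: no; exists g.
have [V0|V0] := posnP V; first by rewrite V0 invr0 mulr0 ler01.
by rewrite ler_pdivrMr ?ltr0n // mul1r ler_nat.
Qed.

Lemma lax_inhabited (t s : nat) (D : finType) (RT : 'I_s -> {set t.-tuple D}) :
  (0 < t)%N -> (0 < s)%N -> lax RT -> (0 < #|D|)%N.
Proof.
move=> t0 s0 RT_lax; have [b _] := RT_lax (Ordinal s0) (Ordinal t0).
by apply/card_gt0P; exists (tnth b (Ordinal t0)).
Qed.

Lemma random_csp_constants (t l : nat) : (1 < t)%N -> (0 < l)%N ->
  exists zeta delta : R -> R, forall Delta : R, 0 < Delta ->
    [/\ 0 < zeta Delta, 0 < delta Delta & exists N0 : nat,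
      forall (n m : nat) (D : finType) (s : nat) (RT : 'I_s -> {set t.-tuple D}),
      (N0 <= n)%N -> (0 < m)%N -> m%:R <= Delta * n%:R -> Delta * n%:R <= m.+1%:R ->
      (0 < s)%N -> lax RT -> null_constraining l RT ->
      delta Delta <= prob n m (fun RA => forall k : nat, (1 <= k)%N ->
        k%:R <= zeta Delta * n%:R -> cohom_accepts RA RT k)].
Proof.
(* The acceptance criterion for [k] asks for sparsity up to [c k] edges, and it is available up to
   [alpha n]; hence [zeta = alpha / c]. *)
move=> t1 l0; pose q := (3 * (l * t + 2)).+1; pose c := (4 * (1 + (t - 1) * (2 * q)))%N.
have c0 : 0 < c%:R :> R by rewrite ltr0n /c muln_gt0.
have Q1 : (1 < 2 * q)%N by rewrite /q; lia.
have /functional_choice[ad adP] : forall Delta : R, exists ad : R * R, 0 < Delta ->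
    [/\ 0 < ad.1, 0 < ad.2 & exists N0 : nat,
    forall n m : nat, (N0 <= n)%N -> m%:R <= Delta * n%:R -> Delta * n%:R <= m.+1%:R ->
    ad.2 <= level_avg (t_sets t n) m (fun S =>
      (pdec (no_short_cycle l S /\ sparse_upto (2 * q) t (ad.1 * n%:R) S))%:R)].
  move=> Delta; have [D0|nD] := boolP (0 < Delta); last by exists (0%R, 0%R).
  by have [a [d adP]] := sparse_girth_probability l t1 Q1 D0; exists (a, d).
exists (fun Delta => ((ad Delta).1 / c%:R)%R), (fun Delta => (ad Delta).2) => Delta D0.
have [a0 d0 [N0 N0P]] := adP _ D0; split=> //; first exact: divr_gt0.
have [N1 N1P] := linear_le_bin Delta t1.
exists (maxn N0 N1) => n m D s RT; rewrite geq_max => /andP[n0 n1] m0 mn nm s0 RT_lax RT_null.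
have mC : (m <= 'C(n, t))%N by rewrite -(ler_nat R); exact: le_trans (N1P n n1).
apply: le_trans (N0P n m n0 mn nm) _.
apply: (prob_ge_level s0 mC) => g gv [nc sp] k k0 kn.
apply: (cohom_accepts_sparse t1 l0 m0 k0 s0 RT_lax RT_null (ltnSn _) gv nc) => F FE cF.
apply: sp => //; apply: le_trans (_ : (c * k)%:R <= _).
  by rewrite ler_nat; apply: leq_trans cF _; rewrite /c !mulnA.
by move: kn; rewrite mulrAC ler_pdivlMr // natrM mulrC.
Qed.

Local Open Scope R_scope.

Theorem mainTheorem2 (t l : nat) (ht : (2 <= t)%N) (hl : (1 <= l)%N) :
  exists zeta delta : R -> R,
  forall (D : finType) (s : nat) (RT : 'I_s -> {set t.-tuple D}),
    (0 < s)%N ->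
    lax RT -> null_constraining l RT -> ~ trivially_satisfiable RT ->
    exists Delta : R, 0 < Delta /\ 0 < zeta Delta /\ 0 < delta Delta /\
      (* w.p. 1 - o(1): no homomorphism A -> T *)
      (forall eps : R, 0 < eps -> exists N : nat, forall n : nat, (N <= n)%N ->
         1 - eps <= prob n (floorR (Delta * INR n))
                      (fun RA => ~ exists h : 'I_n -> D, is_hom RA RT h)) /\
      (* w.p. >= delta - o(1): accepted by cohomological k-consistency
         for all k <= zeta n *)
      (forall eps : R, 0 < eps -> exists N : nat, forall n : nat, (N <= n)%N ->
         delta Delta - eps <= prob n (floorR (Delta * INR n))
             (fun RA => forall k : nat, (1 <= k)%N -> INR k <= zeta Delta * INR n ->
                          cohom_accepts RA RT k)) /\
      (* consequently: for all large n, some unsatisfiable instance on n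
         elements is accepted for every k <= zeta n *)
      (exists N : nat, forall n : nat, (N <= n)%N ->
         exists RA : 'I_s -> {set t.-tuple 'I_n},
           is_instance RA /\ ~ (exists h : 'I_n -> D, is_hom RA RT h) /\
           forall k : nat, (1 <= k)%N -> INR k <= zeta Delta * INR n ->
             cohom_accepts RA RT k).
Proof.
have [zeta [delta constP]] := random_csp_constants ht hl.
exists zeta, delta => D s RT s0 RT_lax RT_null RT_nt.
have D0 := lax_inhabited (ltnW ht) s0 RT_lax.
have RT_nc := not_trivially_satisfiableP RT_nt.
set Dn := (2 * s * (2 * #|D|) ^ t * (#|D| + 1))%N.
(* With [Dn n <= m n + 1] this keeps [m n] positive for [n >= 1] in spite of the rounding. *)
have Dn2 : (2 <= Dn)%N.
  by rewrite /Dn -!mulnA leq_pmulr // !muln_gt0 s0 expn_gt0 muln_gt0 D0 addn1.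
have Delta0 : (0 < Dn%:R :> R)%R by rewrite ltr0n ltnW.
have [z0 d0 [N1 accepted]] := constP _ Delta0.
pose m n := floorR (Dn%:R * INR n).
have mP n : ((m n)%:R <= Dn%:R * n%:R :> R)%R /\ (Dn%:R * n%:R <= (m n).+1%:R :> R)%R.
  by rewrite /m INRE; apply: floorR_bounds; rewrite mulr_ge0 ?ler0n.
have m_gt0 n : (0 < n)%N -> (0 < m n)%N.
  move=> n0; have := (mP n).2; rewrite -natrM ler_nat => h.
  by rewrite -ltnS; apply: leq_trans h; apply: leq_trans Dn2 _; rewrite leq_pmulr.
have unsat (eps : R) : (0 < eps)%R -> exists N : nat, forall n : nat, (N <= n)%N ->
    (1 - eps <= prob n (m n) (fun RA => ~ exists h : 'I_n -> D, is_hom RA RT h))%R.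
  move=> eps0; have [N0 N0P] := unsat_level ht s0 D0 RT_nc eps0.
  have [N2 N2P] := linear_le_bin Dn%:R ht.
  exists (maxn N0 N2) => n; rewrite geq_max => /andP[n0 n2]; have [m1 m2] := mP n.
  have mC : (m n <= 'C(n, t))%N by rewrite -(ler_nat R); exact: le_trans (N2P n n2).
  apply: le_trans (prob_unsat_ge s0 RT mC); rewrite lerD2l lerN2.
  exact: N0P n0 m1 m2.
have accept n : (maxn N1 1 <= n)%N -> (delta Dn%:R <= prob n (m n) (fun RA =>
    forall k : nat, (1 <= k)%N -> k%:R <= zeta Dn%:R * n%:R -> cohom_accepts RA RT k))%R.
  rewrite geq_max => /andP[n1 n0]; have [m1 m2] := mP n.
  exact: accepted n1 (m_gt0 _ n0) m1 m2 s0 RT_lax RT_null.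
have toR (k n : nat) : INR k <= zeta Dn%:R * INR n -> (k%:R <= zeta Dn%:R * n%:R)%R.
  by move/RleP; rewrite !INRE.
have le_prob n (E1 E2 : ('I_s -> {set t.-tuple 'I_n}) -> Prop) :
    (forall RA, E1 RA -> E2 RA) -> (prob n (m n) E1 <= prob n (m n) E2)%R.
  move=> sub; rewrite /prob !RealsE; apply: ler_wpM2r; first by rewrite invr_ge0 ler0n.
  rewrite ler_nat; apply/subset_leq_card/subsetP=> g; rewrite !inE => /andP[-> /pdecP h].
  exact/pdecP/sub.
exists Dn%:R; split; first exact/RltP.
split; first exact/RltP.
split; first exact/RltP.
split.
  by move=> eps /RltP /unsat[N NP]; exists N => n /NP /RleP.
split.
  move=> eps /RltP eps0; exists (maxn N1 1) => n /accept le; apply/RleP.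
  apply: le_trans (le_trans _ le) (le_prob _ _ _ _).
    by rewrite !RealsE; rewrite gerBl ltW.
  by move=> RA acc k k1 /toR; apply: acc.
(* Acceptance has probability at least [delta] with no error term, so an error of [delta / 2] for
   unsatisfiability makes the probabilities add up to more than 1, and some outcome has both
   properties. *)
have [|N NP] := unsat (delta Dn%:R / 2%:R)%R; first by rewrite divr_gt0 ?ltr0n.
exists (maxn N (maxn N1 1)) => n; rewrite geq_max => /andP[/NP p1 /accept p2].
have gt1 : (1 < 1 - delta Dn%:R / 2%:R + delta Dn%:R :> R)%R by lra.
have [g [gv g1 g2]] := prob_both (lt_le_trans gt1 (lerD p1 p2)).
exists (inst_of g); split; first exact: inst_of_is_instance gv.
by split=> // k k1 /toR; apply: g2.
Qed.
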